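(* Let $m=m_n$ be a sequence of positive integers, and for $p\in(0,1)$ let $D_n=\operatorname{des}(\pi)$ be the number of descents of $\pi\sim\nu^{(p)}_{n,m_n}$ (an $(m_n,p)$-shelf shuffle with $n$ cards). Put $q=1-p$. Then the following limits hold as $n\to\infty$, uniformly in the choice of $p=p(n)\in(0,1)$: (1) If $m/n\to0$, then $$\frac{\operatorname{Var}(D_n)}{n}-pq\longrightarrow0.$$ In particular, for fixed $p$, $\operatorname{Var}(D_n)/n\to pq$. (2) If $m/n\to\infty$, then $$\frac{\operatorname{Var}(D_n)}{n}\longrightarrow\frac1{12}.$$
   Context: Asymmetric shelf shuffle: let $m\ge 1$ be an integer, $p\in(0,1)$, $q=1-p$. A deck of $n$ cards labelled $1,\ldots,n$ from top to bottom is dealt sequentially from the bottom (card $n$ first, card $1$ last). Each card is assigned to one of $m$ labelled shelves independently and uniformly at random, and is placed at the top of the existing pile on that shelf with probability $p$ and at the bottom with probability $q$, independently of everything else. The shuffled deck is formed by joining the piles in shelf order (shelf $1$ on top, then shelf $2$, and so on). The resulting random permutation is $\pi=(\pi_1,\ldots,\pi_n)\in S_n$, where $\pi_i$ is the label of the card in position $i$ from the top, and $\nu^{(p)}_{n,m}$ denotes its law on $S_n$. $\operatorname{des}(\pi)=|\{i\in\{1,\ldots,n-1\}:\pi_i>\pi_{i+1}\}|$ is the number of descents. ''Uniformly in the choice of $p=p(n)$'' means that the supremum over $p\in(0,1)$ of the absolute difference between the two sides of the limit tends to $0$. *)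

(* Defs.v *)
From HB Require Import structures.
From mathcomp Require Import all_boot all_order all_algebra all_fingroup.
From mathcomp Require Import all_classical all_reals all_analysis.
Set Implicit Arguments.
Unset Strict Implicit.
Unset Printing Implicit Defensive.
Import Order.TTheory GRing.Theory Num.Theory.
Import numFieldNormedType.Exports.
Local Open Scope ring_scope.

(* Cards, positions and shelves are numbered from 0.  The outcome [w] sends
   card [c] to shelf [(w c).1], on top of the pile there if [(w c).2] is true
   and at the bottom otherwise.  A pile is listed from top to bottom. *)
Definition outcome (n m : nat) := {ffun 'I_n -> 'I_m * bool}.

Definition place (n m : nat) (w : outcome n m) (piles : 'I_m -> seq 'I_n)
    (c : 'I_n) : 'I_m -> seq 'I_n :=
  fun j => if j == (w c).1
           then if (w c).2 then c :: piles j else rcons (piles j) c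
           else piles j.

Definition piles_after_deal (n m : nat) (w : outcome n m) : 'I_m -> seq 'I_n :=
  foldl (place w) (fun=> [::]) (rev (enum 'I_n)).

Definition shuffled_deck (n m : nat) (w : outcome n m) : seq 'I_n :=
  flatten [seq piles_after_deal w j | j <- enum 'I_m].

Definition outcome_prob (R : realType) (n m : nat) (p : R)
    (w : outcome n m) : R :=
  \prod_(c < n) (m%:R^-1 * (if (w c).2 then p else 1 - p)).

Definition shelf_law (R : realType) (n m : nat) (p : R) (s : 'S_n) : R :=
  \sum_(w : outcome n m | shuffled_deck w == [seq s i | i <- enum 'I_n])
    outcome_prob p w.

Definition des (n : nat) (s : 'S_n) : nat :=
  #|[set i : 'I_n | [exists j : 'I_n, (j == i.+1 :> nat) && (s j < s i)%N]]|.

Definition shelf_mean (R : realType) (n m : nat) (p : R)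
    (X : 'S_n -> R) : R :=
  \sum_(s : 'S_n) shelf_law m p s * X s.

Definition shelf_var (R : realType) (n m : nat) (p : R)
    (X : 'S_n -> R) : R :=
  shelf_mean m p (fun s => (X s - shelf_mean m p X) ^+ 2).

Definition var_des (R : realType) (n m : nat) (p : R) : R :=
  shelf_var m p (fun s : 'S_n => (des s)%:R).

(* Main.v *)
Require Import Defs.
From HB Require Import structures.
From mathcomp Require Import all_boot all_order all_algebra all_fingroup.
From mathcomp Require Import all_classical all_reals all_analysis.
From mathcomp Require Import ring lra zify.
Set Implicit Arguments.
Unset Strict Implicit.
Unset Printing Implicit Defensive.
Import Order.TTheory GRing.Theory Num.Theory.
Import numFieldNormedType.Exports.
Local Open Scope ring_scope.

(** An outcome assigns to every card, independently, a shelf and an end of its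
    pile, so the number [D] of descents is a function on a finite product space.
    The idea is to compare [D] with a variable of known variance and to bound the
    variance of the difference with the Efron-Stein inequality
    ([efron_stein]): a function that hardly changes when one card is dropped from
    the deck has a small variance. Dropping a card changes the number of descents
    by an amount in {0, 1} that depends only on the card and its two neighbours
    ([deck_des_insert]). If [Var (X - Y)] is [o(n)] and [Var Y] is [O(n)], then
    [Var X - Var Y] is [o(n)] ([pvar_perturb]).

    Few shelves. The deck consists of [2 m] blocks, alternately increasing and
    decreasing, and the decreasing blocks contain the cards put at the bottom of
    their piles. The number [B] of these cards is binomial, with variance
    [n p q]. Inside a block, a card contributes equally to [D] and to [B], so
    [D - B] changes only if the dropped card is the smallest or the largest of its
    block ([card_gain_inner]). There are at most [4 m] such cards, hence
    [Var (D - B) <= 4 m = o(n)].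

    Many shelves. Give every card a further uniform label below a huge [K], and
    let [D'] be the number of descents of the deck in which the order inside a
    shelf is decided by the labels. The variables [D] and [D'] react differently
    to the loss of a card only if this card or one of its neighbours shares its
    shelf with another card ([card_gain_eq]). The mean number of cards that share
    their shelf is at most [n^2 / m], hence [Var (D - D') <= 3 n^2 / m = o(n)].
    When the labels are distinct, relabelling the cards shows that the finer deck
    is uniform ([mean_distinct]), so [Var D'] is close to the variance of the
    descents of a uniform permutation, [(n + 1) / 12], which follows from the
    means of products of two inversion signs.

    Both estimates are explicit inequalities that do not involve [p] on the right
    ([few_shelves_bound], [many_shelves_bound]), whence the uniformity. *)

(** * Means over finite product spaces *)

Section ProductMean.
Context (R : realFieldType) (I T : finType) (mu : T -> R).
Hypothesis mu_ge0 : forall t, 0 <= mu t.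
Hypothesis mu_sum1 : \sum_t mu t = 1.
Implicit Types (f g h : {ffun I -> T} -> R) (w : {ffun I -> T}) (i j : I).

(** The expectation of [f] when the coordinates are drawn independently with the
    weights [mu]. *)
Definition pmean f : R := \sum_(w : {ffun I -> T}) (\prod_i mu (w i)) * f w.

Definition pvar f : R := pmean (fun w => (f w - pmean f) ^+ 2).

Lemma eq_pmean f g : f =1 g -> pmean f = pmean g.
Proof. by move=> fg; apply: eq_bigr => w _; rewrite fg. Qed.

Lemma pmean_prod (F : I -> T -> R) :
  pmean (fun w => \prod_i F i (w i)) = \prod_i \sum_t mu t * F i t.
Proof.
rewrite bigA_distr_bigA; apply: eq_bigr => w _.
by rewrite -big_split.
Qed.

Lemma weight_sum1 : \sum_(w : {ffun I -> T}) \prod_i mu (w i) = 1.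
Proof. by rewrite -(bigA_distr_bigA (fun=> mu)) big1. Qed.

Lemma pmean_cst (a : R) : pmean (fun=> a) = a.
Proof. by rewrite /pmean -mulr_suml weight_sum1 mul1r. Qed.

Lemma weight_ge0 w : 0 <= \prod_i mu (w i).
Proof. by apply: prodr_ge0 => i _. Qed.

Lemma ler_pmean f g : (forall w, f w <= g w) -> pmean f <= pmean g.
Proof.
by move=> fg; apply: ler_sum => w _; apply: ler_wpM2l => //; apply: weight_ge0.
Qed.

Lemma pmean_ge0 f : (forall w, 0 <= f w) -> 0 <= pmean f.
Proof. by move=> f_ge0; rewrite -(pmean_cst 0); apply: ler_pmean. Qed.

Lemma pmeanD f g : pmean (fun w => f w + g w) = pmean f + pmean g.
Proof. by rewrite /pmean -big_split; apply: eq_bigr => w _; rewrite mulrDr. Qed.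

Lemma pmeanZ (a : R) f : pmean (fun w => a * f w) = a * pmean f.
Proof. by rewrite /pmean mulr_sumr; apply: eq_bigr => w _; rewrite mulrCA. Qed.

Lemma pmeanB f g : pmean (fun w => f w - g w) = pmean f - pmean g.
Proof.
rewrite -[- pmean g]mulN1r -pmeanZ -pmeanD.
by apply: eq_pmean => w; rewrite mulN1r.
Qed.

Lemma pmean_sum (J : finType) (P : pred J) (F : J -> {ffun I -> T} -> R) :
  pmean (fun w => \sum_(j | P j) F j w) = \sum_(j | P j) pmean (F j).
Proof.
rewrite /pmean exchange_big; apply: eq_bigr => w _.
by rewrite mulr_sumr.
Qed.

Lemma ler_norm_pmean f : `|pmean f| <= pmean (fun w => `|f w|).
Proof.
apply: le_trans (ler_norm_sum _ _ _) _; apply: ler_sum => w _.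
by rewrite normrM ger0_norm ?weight_ge0.
Qed.

Lemma pvarE f : pvar f = pmean (fun w => f w ^+ 2) - pmean f ^+ 2.
Proof.
rewrite /pvar.
transitivity (pmean (fun w => f w ^+ 2 + (- 2 * pmean f * f w + pmean f ^+ 2))).
  by apply: eq_pmean => w; ring.
by rewrite pmeanD pmeanD pmeanZ pmean_cst; ring.
Qed.

Lemma pvar_ge0 f : 0 <= pvar f.
Proof. by apply: pmean_ge0 => w; apply: sqr_ge0. Qed.

(** Young's inequality applied to the covariance term of the variance of
    [f = g + (f - g)]: it replaces Cauchy-Schwarz and its square roots. *)
Lemma pvar_perturb f g (eta : R) : 0 < eta ->
  `|pvar f - pvar g| <=
    eta * pvar g + (1 + eta^-1) * pvar (fun w => f w - g w).
Proof.
move=> eta_gt0; set h := fun w => f w - g w.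
set X := fun w => g w - pmean g; set Y := fun w => h w - pmean h.
have -> : pvar f = pmean (fun w => X w ^+ 2 + (2 * (X w * Y w) + Y w ^+ 2)).
  apply: eq_pmean => w; rewrite /X /Y /h pmeanB; ring.
rewrite pmeanD -/(pvar g) addrC addKr pmeanD -/(pvar h) pmeanZ.
have V_ge0 := pvar_ge0 h.
(* The signs [s = 1] and [s = -1] give the two sides of the absolute value. *)
have young s : s ^+ 2 = 1 ->
    s * (2 * pmean (fun w => X w * Y w)) <= eta * pvar g + eta^-1 * pvar h.
  move=> s2; rewrite -!pmeanZ -pmeanD; apply: ler_pmean => w.
  have /mulr_ge0 : 0 <= eta^-1 by rewrite invr_ge0 ltW.
  move=> /(_ _ (sqr_ge0 (eta * X w - s * Y w))).
  have -> : eta^-1 * (eta * X w - s * Y w) ^+ 2 =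
      (eta^-1 * eta) * eta * X w ^+ 2 - (eta^-1 * eta) * (2 * s * (X w * Y w)) +
      eta^-1 * (s ^+ 2 * Y w ^+ 2) by ring.
  rewrite -/(X w) -/(Y w) s2 mulVf ?gt_eqF //; lra.
have := young 1 (expr1n _ _); have := young (- 1) (sqrr_sign _ 1).
by rewrite ler_norml; lra.
Qed.

(** * The Efron-Stein inequality *)

Definition update w i (t : T) : {ffun I -> T} :=
  [ffun j => if j == i then t else w j].

Definition avg i f : {ffun I -> T} -> R :=
  fun w => \sum_t mu t * f (update w i t).

Definition free_of i f := forall w t, f (update w i t) = f w.

Lemma update_update w i s t : update (update w i s) i t = update w i t.
Proof. by apply/ffunP => j; rewrite !ffunE; case: eqP. Qed.

Lemma update_comm w i j s t : i != j ->
  update (update w i s) j t = update (update w j t) i s.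
Proof.
move=> ij; apply/ffunP => k; rewrite !ffunE.
by case: (eqVneq k j) => // ->; rewrite eq_sym (negPf ij).
Qed.

Lemma update_id w i : update w i (w i) = w.
Proof. by apply/ffunP => j; rewrite ffunE; case: eqP => // ->. Qed.

Lemma free_avg i f : free_of i (avg i f).
Proof. by move=> w t; apply: eq_bigr => s _; rewrite update_update. Qed.

Lemma avg_free i j f : free_of j f -> free_of j (avg i f).
Proof.
move=> fj w t; have [<-|ij] := eqVneq i j; first exact: free_avg.
by apply: eq_bigr => s _; rewrite update_comm 1?eq_sym // fj.
Qed.

(** Exchanging the value at [i] with an independent copy preserves the product
    measure, hence averaging over the coordinate [i] preserves means. *)
Lemma pmean_avg i f : pmean (avg i f) = pmean f.
Proof.
have -> : pmean f =
    \sum_(p : {ffun I -> T} * T) (\prod_j mu (p.1 j)) * mu p.2 * f p.1.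
  rewrite -(pair_big predT predT
     (fun w t => (\prod_j mu (w j)) * mu t * f w)) /=.
  by apply: eq_bigr => w _; rewrite -mulr_suml -mulr_sumr mu_sum1 mulr1.
pose swap (p : {ffun I -> T} * T) := (update p.1 i p.2, p.1 i).
have swapK : involutive swap.
  move=> [w t]; rewrite /swap /= update_update update_id.
  by rewrite /update ffunE eqxx.
rewrite (reindex_inj (inv_inj swapK)) /=.
rewrite -(pair_big predT predT (fun w t =>
  (\prod_j mu (update w i t j)) * mu (w i) * f (update w i t))) /=.
apply: eq_bigr => w _; rewrite mulr_sumr; apply: eq_bigr => t _.
rewrite mulrA; congr (_ * _).
rewrite (bigD1 i) //= [in RHS](bigD1 i) //= {1}/update ffunE eqxx.
rewrite [in RHS](eq_bigr (fun j => mu (w j))); last first.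
  by move=> j ji; rewrite /update ffunE (negPf ji).
ring.
Qed.

Lemma avg_sqrB i f g w : free_of i g ->
  avg i (fun v => (f v - g v) ^+ 2) w =
  avg i (fun v => f v ^+ 2) w - 2 * g w * avg i f w + g w ^+ 2.
Proof.
move=> gi; rewrite /avg.
transitivity (\sum_t (mu t * f (update w i t) ^+ 2 +
   (- (2 * g w * (mu t * f (update w i t))) + mu t * g w ^+ 2))).
  by apply: eq_bigr => t _; rewrite gi; ring.
rewrite !big_split /= sumrN -mulr_sumr -mulr_suml mu_sum1; ring.
Qed.

Lemma avg_ge0 i f w : (forall v, 0 <= f v) -> 0 <= avg i f w.
Proof. by move=> f_ge0; apply: sumr_ge0 => t _; apply: mulr_ge0. Qed.

Lemma pmean_sqr_avg i f :
  pmean (fun w => avg i f w ^+ 2) <= pmean (fun w => f w ^+ 2).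
Proof.
rewrite -[leRHS](pmean_avg i); apply: ler_pmean => w.
have := avg_ge0 i w (fun v => sqr_ge0 (f v - avg i f v)).
rewrite avg_sqrB; last exact: free_avg.
have -> : 2 * avg i f w * avg i f w = 2 * avg i f w ^+ 2 by ring.
lra.
Qed.

Lemma avg_defect i f g : free_of i g ->
  pmean (fun w => f w ^+ 2) - pmean (fun w => avg i f w ^+ 2) <=
  pmean (fun w => (f w - g w) ^+ 2).
Proof.
move=> gi; rewrite -(pmean_avg i (fun w => f w ^+ 2)).
rewrite -(pmean_avg i (fun w => (f w - g w) ^+ 2)) -pmeanB.
apply: ler_pmean => w; rewrite avg_sqrB //.
have := sqr_ge0 (avg i f w - g w).
by rewrite sqrrB -[_ *+ 2]mulr_natl; lra.
Qed.

Definition avgs (s : seq I) f := foldl (fun h i => avg i h) f s.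

Lemma pmean_avgs s f : pmean (avgs s f) = pmean f.
Proof. by elim: s f => //= i s IHs f; rewrite IHs pmean_avg. Qed.

Lemma avgs_free s j f : free_of j f -> free_of j (avgs s f).
Proof. by elim: s f => //= i s IHs f fj; apply/IHs/avg_free. Qed.

Lemma free_avgs s j f : j \in s -> free_of j (avgs s f).
Proof.
elim: s f => //= i s IHs f; rewrite inE => /orP[/eqP->|]; last exact: IHs.
exact/avgs_free/free_avg.
Qed.

(** Averaging one coordinate loses at most [pmean ((f - g i) ^+ 2)] of the second
    moment, and averaging contracts the remaining terms. *)
Lemma avgs_defect s f (g : I -> {ffun I -> T} -> R) :
  (forall i, free_of i (g i)) ->
  pmean (fun w => f w ^+ 2) - pmean (fun w => avgs s f w ^+ 2) <=
  \sum_(i <- s) pmean (fun w => (f w - g i w) ^+ 2).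
Proof.
elim: s f g => [|i s IHs] f g gfree; first by rewrite big_nil subrr.
rewrite big_cons /=.
have IH := IHs (avg i f) (fun j => avg i (g j)) (fun j => avg_free i (gfree j)).
apply: (@le_trans _ _ (pmean (fun w => (f w - g i w) ^+ 2) +
   \sum_(j <- s) pmean (fun w => (avg i f w - avg i (g j) w) ^+ 2))).
  have := avg_defect f (gfree i); lra.
rewrite lerD2l; apply: ler_sum => j _.
have -> : pmean (fun w => (avg i f w - avg i (g j) w) ^+ 2) =
    pmean (fun w => avg i (fun v => f v - g j v) w ^+ 2).
  apply: eq_pmean => w; congr (_ ^+ 2); rewrite /avg -sumrB.
  by apply: eq_bigr => t _; rewrite mulrBr.
exact: pmean_sqr_avg.
Qed.

Lemma free_all_cst f w w' : (forall i, free_of i f) -> f w = f w'.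
Proof.
move=> ffree.
have patch (s : seq I) : f [ffun j => if j \in s then w' j else w j] = f w.
  elim: s => [|i s IHs]; first by congr f; apply/ffunP => j; rewrite ffunE.
  rewrite -IHs -[RHS](ffree i _ (w' i)); congr f; apply/ffunP => j.
  by rewrite !ffunE inE; case: eqP => // ->.
rewrite -(patch (enum I)); congr f; apply/ffunP => j.
by rewrite ffunE mem_enum.
Qed.

(** The Efron-Stein inequality, in the form that bounds the variance by how well
    [f] is approximated by functions that ignore one coordinate. *)
Theorem efron_stein f (g : I -> {ffun I -> T} -> R) :
  (forall i, free_of i (g i)) ->
  pvar f <= \sum_i pmean (fun w => (f w - g i w) ^+ 2).
Proof.
move=> gfree; rewrite pvarE.
have := avgs_defect (enum I) f gfree; rewrite big_enum /=; apply: le_trans.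
rewrite lerD2l lerN2 -(pmean_avgs (enum I) f).
(* Once all coordinates are averaged out, only the constant [pmean f] remains. *)
set h := avgs _ _.
have hfree i : free_of i h by apply: free_avgs; rewrite mem_enum.
have hE w : h w = pmean h.
  rewrite -[LHS]pmean_cst; apply: eq_pmean => v; exact: free_all_cst.
rewrite -[pmean h ^+ 2]pmean_cst; apply: ler_pmean => w.
by rewrite hE.
Qed.

Lemma pmean_pair i j (f1 f2 : T -> R) : i != j ->
  pmean (fun w => f1 (w i) * f2 (w j)) =
  (\sum_t mu t * f1 t) * (\sum_t mu t * f2 t).
Proof.
move=> ij.
pose F k t := if k == i then f1 t else if k == j then f2 t else 1.
transitivity (pmean (fun w => \prod_k F k (w k))).
  apply: eq_pmean => w; rewrite (bigD1 i) //= (bigD1 j) 1?eq_sym //= big1.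
    by rewrite /F eqxx eq_sym (negPf ij) eqxx mulr1.
  by move=> k /andP[ki kj]; rewrite /F (negPf ki) (negPf kj).
rewrite pmean_prod (bigD1 i) //= (bigD1 j) 1?eq_sym //= [X in _ * (_ * X)]big1.
  by rewrite mulr1 /F eqxx eq_sym (negPf ij) eqxx.
move=> k /andP[ki kj]; rewrite -[RHS]mu_sum1; apply: eq_bigr => t _.
by rewrite /F (negPf ki) (negPf kj) mulr1.
Qed.

Lemma pmean_single i (f1 : T -> R) :
  pmean (fun w => f1 (w i)) = \sum_t mu t * f1 t.
Proof.
pose F k t := if k == i then f1 t else 1.
transitivity (pmean (fun w => \prod_k F k (w k))).
  apply: eq_pmean => w; rewrite (bigD1 i) //= big1 /F ?eqxx ?mulr1 //.
  by move=> k /negPf->.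
rewrite pmean_prod (bigD1 i) //= [X in _ * X]big1 /F ?eqxx ?mulr1 // => k /negPf->.
by rewrite -[RHS]mu_sum1; apply: eq_bigr => t _; rewrite mulr1.
Qed.

(** Two coordinates are independent, so they collide under a labelling [h] whose
    classes all have weight [a] with probability [a]. *)
Lemma pmean_collision (L : finType) (h : T -> L) (a : R) i j : i != j ->
  (forall l, \sum_(t | h t == l) mu t = a) ->
  pmean (fun w => (h (w i) == h (w j))%:R) = a.
Proof.
move=> ij ha.
transitivity (pmean (fun w => \sum_l (h (w i) == l)%:R * (h (w j) == l)%:R)).
  apply: eq_pmean => w; rewrite (bigD1 (h (w i))) //= eqxx mul1r big1 ?addr0.
    by rewrite eq_sym.
  by move=> l /negPf hl; rewrite eq_sym hl mul0r.
have ind l : \sum_t mu t * (h t == l)%:R = a.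
  by rewrite -[RHS](ha l) [RHS]big_mkcond; apply: eq_bigr => t _; rewrite mulr_natr mulrb.
rewrite pmean_sum.
under eq_bigr do rewrite (pmean_pair (fun t => (h t == _)%:R)
  (fun t => (h t == _)%:R) ij) ind.
rewrite -mulr_suml (_ : \sum_(l : L) a = 1) ?mul1r //.
rewrite -[RHS]mu_sum1 (partition_big h predT) //=.
by apply: eq_bigr => l _; rewrite -(ha l).
Qed.

Lemma pmean_perm (s : {perm I}) f :
  pmean (fun w => f [ffun i => w (s i)]) = pmean f.
Proof.
pose F (w : {ffun I -> T}) : {ffun I -> T} := [ffun i => w (s i)].
have F_inj : injective F.
  move=> v w /ffunP vw; apply/ffunP => i.
  by have := vw (s^-1%g i); rewrite !ffunE permKV.
rewrite /pmean [RHS](reindex_inj F_inj); apply: eq_bigr => w _; congr (_ * _).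
rewrite (reindex_inj (@perm_inj _ s)); apply: eq_bigr => i _; congr mu.
by rewrite ffunE.
Qed.

End ProductMean.

(** Independent draws stay independent after applying [h] to each of them. *)
Lemma pmean_image (R : realFieldType) (I T T' : finType) (mu : T -> R)
    (nu : T' -> R) (h : T' -> T) (f : {ffun I -> T} -> R) :
  (forall t, \sum_(t' | h t' == t) nu t' = mu t) ->
  pmean nu (fun w => f [ffun i => h (w i)]) = pmean mu f.
Proof.
move=> hmu; rewrite /pmean.
rewrite (partition_big (fun w : {ffun I -> T'} => [ffun i => h (w i)]) predT) //=.
apply: eq_bigr => w _.
rewrite (eq_bigr (fun v : {ffun I -> T'} => (\prod_i nu (v i)) * f w)); last first.
  by move=> v /eqP->.
rewrite -mulr_suml; congr (_ * _).
rewrite -(eq_bigr _ (fun i _ => hmu (w i))).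
rewrite (bigA_distr_big_dep (fun i t' => h t' == w i)).
apply: eq_bigl => v; apply/eqP/familyP => [<- i|vw].
  by rewrite unfold_in /= ffunE.
by apply/ffunP => i; rewrite ffunE; have := vw i; rewrite unfold_in /= => /eqP.
Qed.

(** * Descents of lists and decks sorted by a key *)

Section Descents.
Local Open Scope nat_scope.

(** The initial sentinel [0] is never followed by a descent, so the first entry
    needs no special treatment. *)
Definition descents (s : seq nat) : nat :=
  sumn (pairmap (fun x y => (y < x) : nat) 0 s).

(** What inserting [c] between [a] and [b] adds to the descents. The subtraction
    is exact: if [b < a] then [c < a] or [b < c]. *)
Definition gain (a c b : nat) : nat := (c < a) + (b < c) - (b < a).

Lemma gain_le1 a c b : gain a c b <= 1.
Proof. rewrite /gain; lia. Qed.

Lemma descents_insert n s1 c s2 : all (fun x => x < n) (s1 ++ c :: s2) ->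
  descents (s1 ++ c :: s2) =
  descents (s1 ++ s2) + gain (last 0 s1) c (head n s2).
Proof.
rewrite all_cat /= /descents !pairmap_cat !sumn_cat => /and3P[s1n cn s2n].
have an : last 0 s1 <= n.
  by elim/last_ind: s1 s1n => // s x _; rewrite all_rcons last_rcons => /andP[/ltnW].
rewrite -addnA; congr (_ + _); rewrite /gain.
by case: s2 s2n => [|b s2] /= s2n; lia.
Qed.

Lemma descents_sum s :
  descents s = \sum_(i < size s) (nth 0 s i < nth 0 (0 :: s) i).
Proof.
suff gen x : sumn (pairmap (fun x y => (y < x) : nat) x s) =
    \sum_(i < size s) (nth 0 s i < nth 0 (x :: s) i) by apply: gen.
elim: s x => [|y s IHs] x /=; first by rewrite big_ord0.
by rewrite big_ord_recl IHs.
Qed.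

Lemma descents_le s : descents s <= size s.
Proof.
rewrite descents_sum -[leqRHS]card_ord -sum1_card.
by apply: leq_sum => i _; apply: leq_b1.
Qed.

End Descents.

Section Decks.
Local Open Scope nat_scope.
Variable n : nat.
Implicit Types (k : 'I_n -> nat) (a b c d : 'I_n).

Definition deck k : seq 'I_n := sort (relpre k leq) (enum 'I_n).

Definition deck_without c k : seq 'I_n :=
  sort (relpre k leq) [seq d <- enum 'I_n | d != c].

Definition deck_des (s : seq 'I_n) : nat := descents [seq val c | c <- s].

Definition covers k a c := (k a < k c) && [forall d, ~~ (k a < k d < k c)].

(** The neighbours of a card, with sentinels [0] and [n] at the two ends of the
    deck that create no descent. *)
Definition above k c : nat := oapp val 0 [pick a | covers k a c].
Definition below k c : nat := oapp val n [pick b | covers k c b].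

Definition card_gain k c : nat := gain (above k c) c (below k c).

Lemma key_total k : total (relpre k leq).
Proof. by move=> a b; apply: leq_total. Qed.

Lemma key_trans k : transitive (relpre k leq).
Proof. by move=> a b c; apply: leq_trans. Qed.

Lemma mem_deck k c : c \in deck k.
Proof. by rewrite mem_sort mem_enum. Qed.

Lemma deck_uniq k : uniq (deck k).
Proof. by rewrite sort_uniq enum_uniq. Qed.

Lemma size_deck k : size (deck k) = n.
Proof. by rewrite size_sort size_enum_ord. Qed.

Lemma deck_perm k : perm_eq (deck k) (enum 'I_n).
Proof. by apply/permPl/perm_sort. Qed.

Lemma deck_unique k s : injective k -> sorted (relpre k leq) s ->
  perm_eq s (enum 'I_n) -> s = deck k.
Proof.
move=> k_inj s_sorted s_perm.
apply: (sorted_eq (@key_trans k)) => //.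
- by move=> a b; rewrite -eqn_leq => /eqP/k_inj.
- exact/sort_sorted/key_total.
- by rewrite (perm_trans s_perm) // perm_sym deck_perm.
Qed.

Lemma deck_des_le k : deck_des (deck k) <= n.
Proof. by apply: leq_trans (descents_le _) _; rewrite size_map size_deck. Qed.

Lemma covers_uniql k a a' c : injective k ->
  covers k a c -> covers k a' c -> a = a'.
Proof.
move=> k_inj /andP[ac /forallP ca] /andP[ac' /forallP ca']; apply: k_inj.
have := ca a'; have := ca' a; lia.
Qed.

Lemma covers_uniqr k c b b' : injective k ->
  covers k c b -> covers k c b' -> b = b'.
Proof.
move=> k_inj /andP[cb /forallP ca] /andP[cb' /forallP ca']; apply: k_inj.
have := ca b'; have := ca' b; lia.
Qed.

Lemma aboveE k a c : injective k -> covers k a c -> above k c = a.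
Proof.
move=> k_inj ac; rewrite /above; case: pickP => [a' a'c|/(_ a)] /=.
  by rewrite (covers_uniql k_inj a'c ac).
by rewrite ac.
Qed.

Lemma belowE k c b : injective k -> covers k c b -> below k c = b.
Proof.
move=> k_inj cb; rewrite /below; case: pickP => [b' cb'|/(_ b)] /=.
  by rewrite (covers_uniqr k_inj cb' cb).
by rewrite cb.
Qed.

Lemma exists_above k a c : k a < k c ->
  exists2 a', covers k a' c & k a <= k a'.
Proof.
move=> ac; pose P d := k d < k c.
case: (@arg_maxnP _ a P k ac) => a' a'c a'max.
exists a'; last exact: a'max.
apply/andP; split=> //; apply/forallP => d; apply/negP => /andP[a'd dc].
by have := a'max d dc; rewrite /= leqNgt a'd.
Qed.

Lemma exists_below k c b : k c < k b ->
  exists2 b', covers k c b' & k b' <= k b.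
Proof.
move=> cb; pose P d := k c < k d.
case: (@arg_minnP _ b P k cb) => b' cb' b'min.
exists b'; last exact: b'min.
apply/andP; split=> //; apply/forallP => d; apply/negP => /andP[cd db'].
by have := b'min d cd; rewrite leqNgt db'.
Qed.

Lemma deck_split k c : injective k -> exists s1 s2,
  [/\ deck k = s1 ++ c :: s2, deck_without c k = s1 ++ s2,
      last 0 [seq val d | d <- s1] = above k c
    & head n [seq val d | d <- s2] = below k c].
Proof.
move=> k_inj.
have all_deck := mem_deck k.
have without : deck_without c k = [seq d <- deck k | d != c].
  by rewrite /deck filter_sort //; [exact: key_total|exact: key_trans].
have deckU := deck_uniq k.
have : sorted ltn (map k (deck k)).
  rewrite ltn_sorted_uniq_leq map_inj_uniq // deckU /= sorted_map.
  exact/sort_sorted/key_total.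
rewrite (sorted_pairwise ltn_trans).
move: without all_deck deckU; have := mem_deck k c.
move: (deck k) => s /splitPr[s1 s2] without all_deck deckU.
rewrite map_cat /= pairwise_cat /= => /and4P[/allrelP s12 s1P cs2 s2P].
exists s1, s2; split=> //.
- rewrite without filter_cat /= eqxx /=; congr (_ ++ _); apply/all_filterP/allP.
  + move=> d ds1; apply/eqP => dc; move: deckU; rewrite cat_uniq => /and3P[_ + _].
    by rewrite /= -dc ds1.
  + move=> d ds2; apply/eqP => dc; move: deckU; rewrite cat_uniq /= => /and4P[_ _ + _].
    by rewrite -dc ds2.
- have s1c d : d \in s1 -> k d < k c.
    by move=> ds1; apply: s12; rewrite ?map_f // inE eqxx.
  have cs2' d : d \in s2 -> k c < k d.
    by move=> ds2; move/allP: cs2; apply; rewrite map_f.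
  case/lastP: s1 {s12 deckU without} s1P s1c all_deck => [|s1 a] s1P s1c all_deck.
    rewrite /above; case: pickP => //= a /andP[ac _].
    have := all_deck a; rewrite inE => /orP[/eqP ac'|/cs2'].
      by rewrite ac' ltnn in ac.
    by rewrite ltnNge (ltnW ac).
  rewrite map_rcons last_rcons; apply/esym/aboveE => //.
  apply/andP; split; first by apply: s1c; rewrite mem_rcons inE eqxx.
  apply/forallP => d; apply/negP => /andP[ad dc].
  have := all_deck d; rewrite mem_cat mem_rcons !inE -orbA => /or4P[/eqP da|ds1|/eqP dc'|/cs2'].
  + by rewrite da ltnn in ad.
  + move: s1P; rewrite map_rcons pairwise_rcons => /andP[/allP/(_ (k d))].
    by rewrite map_f // => /(_ isT) /=; rewrite ltnNge (ltnW ad).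
  + by rewrite dc' ltnn in dc.
  + by rewrite ltnNge (ltnW dc).
- have s1c d : d \in s1 -> k d < k c.
    by move=> ds1; apply: s12; rewrite ?map_f // inE eqxx.
  have cs2' d : d \in s2 -> k c < k d.
    by move=> ds2; move/allP: cs2; apply; rewrite map_f.
  case: s2 {s12 cs2 deckU without} s2P cs2' all_deck => [|b s2] s2P cs2' all_deck.
    rewrite /below; case: pickP => //= b /andP[cb _].
    have := all_deck b; rewrite mem_cat inE => /orP[/s1c|/eqP bc].
      by rewrite ltnNge (ltnW cb).
    by rewrite bc ltnn in cb.
  rewrite /=; apply/esym/belowE => //.
  apply/andP; split; first by apply: cs2'; rewrite inE eqxx.
  apply/forallP => d; apply/negP => /andP[cd db].
  have := all_deck d; rewrite mem_cat !inE => /or4P[/s1c|/eqP dc|/eqP db'|ds2].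
  + by rewrite ltnNge (ltnW cd).
  + by rewrite dc ltnn in cd.
  + by rewrite db' ltnn in db.
  + move: s2P => /= /andP[/allP/(_ (k d))].
    by rewrite map_f // => /(_ isT) /=; rewrite ltnNge (ltnW db).
Qed.

(** Inserting a card into the deck changes the number of descents by an amount
    that depends only on the card and its two neighbours. *)
Lemma deck_des_insert k c : injective k ->
  deck_des (deck k) = deck_des (deck_without c k) + card_gain k c.
Proof.
move=> /(@deck_split k c)[s1 [s2 [-> ->]]]; rewrite /card_gain => <- <-.
rewrite /deck_des !map_cat /=; apply: descents_insert.
by apply/allP => x; rewrite -map_cons -map_cat => /mapP[d _ ->]; apply: ltn_ord.
Qed.

(** The deck without [c] ignores the coordinate of [c], as the Efron-Stein
    inequality requires of an approximation. *)
Lemma deck_without_eq k k' c : injective k -> (forall d, d != c -> k d = k' d) ->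
  deck_without c k = deck_without c k'.
Proof.
move=> k_inj kk'; apply: (sorted_eq (@key_trans k)).
- by move=> a b; rewrite -eqn_leq => /eqP/k_inj.
- exact/sort_sorted/key_total.
- rewrite (@eq_in_sorted _ (predC1 c) _ (relpre k' leq)).
  + exact/sort_sorted/key_total.
  + by move=> a b ac bc; rewrite /= !kk'.
  + by rewrite all_sort; apply/allP => d; rewrite mem_filter => /andP[].
- by rewrite perm_sort perm_sym perm_sort.
Qed.

(** * Decks that differ only inside the classes of a coarser ranking *)

Definition colliding (h : 'I_n -> nat) c := [exists d, (d != c) && (h d == h c)].

(** The cards at which two decks sorted by refinements of the ranking [h] may
    have different neighbours. *)
Definition perturbed (h : 'I_n -> nat) k c :=
  [|| colliding h c, [exists a, covers k a c && colliding h a]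
    | [exists b, covers k c b && colliding h b]].

Section Locality.
Variables (h k k' : 'I_n -> nat).
Hypotheses (k_inj : injective k) (k'_inj : injective k').
Hypothesis hk : forall a b, h a < h b -> k a < k b.
Hypothesis hk' : forall a b, h a < h b -> k' a < k' b.

Lemma alone_neq a d : ~~ colliding h a -> d != a -> h d != h a.
Proof. by rewrite negb_exists => /forallP/(_ d); rewrite negb_and => /orP[/negPf->|]. Qed.

Lemma alone_lt a d (f : 'I_n -> nat) : (forall a b, h a < h b -> f a < f b) ->
  ~~ colliding h a -> (f d < f a) = (h d < h a).
Proof.
move=> hf aP; have [->|da] := eqVneq d a; first by rewrite !ltnn.
have := alone_neq aP da; have := hf d a; have := hf a d; lia.
Qed.

Lemma alone_gt a d (f : 'I_n -> nat) : (forall a b, h a < h b -> f a < f b) ->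
  ~~ colliding h a -> (f a < f d) = (h a < h d).
Proof.
move=> hf aP; have [->|da] := eqVneq d a; first by rewrite !ltnn.
have := alone_neq aP da; have := hf d a; have := hf a d; lia.
Qed.

(** If neither [c] nor the card above it shares its class, then the class of the
    latter is the one just before the class of [c], in every refinement of [h]. *)
Lemma above_eq c : ~~ perturbed h k c -> above k c = above k' c.
Proof.
rewrite !negb_or => /and3P[cP /existsPn acP _].
rewrite {1}/above; case: pickP => [a ac|no_above] /=.
  have := acP a; rewrite ac /= => aP; symmetry; apply: aboveE => //.
  case/andP: ac => ac /forallP ac'; apply/andP; split.
    by rewrite (alone_lt _ hk' cP) -(alone_lt _ hk cP).
  apply/forallP => d; have := ac' d.
  by rewrite (alone_lt _ hk' cP) (alone_gt _ hk' aP) (alone_lt _ hk cP) (alone_gt _ hk aP).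
rewrite /above; case: pickP => //= a /andP[ac _].
have : k a < k c by rewrite (alone_lt _ hk cP) -(alone_lt _ hk' cP).
by case/exists_above => a'; rewrite no_above.
Qed.

Lemma below_eq c : ~~ perturbed h k c -> below k c = below k' c.
Proof.
rewrite !negb_or => /and3P[cP _ /existsPn cbP].
rewrite {1}/below; case: pickP => [b cb|no_below] /=.
  have := cbP b; rewrite cb /= => bP; symmetry; apply: belowE => //.
  case/andP: cb => cb /forallP cb'; apply/andP; split.
    by rewrite (alone_gt _ hk' cP) -(alone_gt _ hk cP).
  apply/forallP => d; have := cb' d.
  by rewrite (alone_lt _ hk' bP) (alone_gt _ hk' cP) (alone_lt _ hk bP) (alone_gt _ hk cP).
rewrite /below; case: pickP => //= b /andP[cb _].
have : k c < k b by rewrite (alone_gt _ hk cP) -(alone_gt _ hk' cP).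
by case/exists_below => b'; rewrite no_below.
Qed.

Lemma card_gain_eq c : ~~ perturbed h k c -> card_gain k c = card_gain k' c.
Proof. by move=> cP; rewrite /card_gain above_eq // below_eq. Qed.

(** Double counting: [a] is related to at most one card. *)
Lemma sum_exists_le (B : pred 'I_n) (r : 'I_n -> 'I_n -> bool) :
  (forall a c c', r a c -> r a c' -> c = c') ->
  \sum_c [exists a, r a c && B a] <= \sum_a B a.
Proof.
move=> r_fun.
apply: (@leq_trans (\sum_c \sum_a (r a c && B a))).
  apply: leq_sum => c _; case: existsP => // -[a ra].
  by rewrite (bigD1 a) //= ra.
rewrite exchange_big; apply: leq_sum => a _.
case: (B a); last by rewrite big1 // => c _; rewrite andbF.
under eq_bigr do rewrite andbT.
rewrite -big_mkcond /= sum1_card; apply/card_le1_eqP => c c'.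
by rewrite !unfold_in => rc rc'; apply: r_fun rc' rc.
Qed.

Lemma sum_perturbed_le :
  \sum_c perturbed h k c <= 3 * \sum_c colliding h c.
Proof.
apply: (@leq_trans (\sum_c (colliding h c +
    ([exists a, covers k a c && colliding h a] +
     [exists b, covers k c b && colliding h b])))).
  by apply: leq_sum => c _; rewrite /perturbed; lia.
rewrite !big_split /= mulSn mul2n -addnn leq_add2l leq_add //.
  by apply: sum_exists_le => a c c'; apply: covers_uniqr.
by apply: (@sum_exists_le _ (fun b c => covers k c b)) => b c c'; apply: covers_uniql.
Qed.

End Locality.

End Decks.

(** * The deck of an outcome *)

Section ShelfDeck.
Local Open Scope nat_scope.
Variables n m : nat.
Implicit Types (w : outcome n m) (a b c d : 'I_n) (t : 'I_m * bool).

(** The deck of [w] is cut into [2 * m] blocks, one for each shelf and each end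
    of its pile: the cards put on top of a pile increase, the cards put at its
    bottom decrease. *)
Definition block_rank t : nat := t.1 * 2 + ~~ t.2.

Definition shelf_key w c : nat :=
  block_rank (w c) * n + (if (w c).2 then nat_of_ord c else n.-1 - c).

Lemma block_rank_inj : injective block_rank.
Proof.
move=> [i x] [j y]; rewrite /block_rank /= => ij.
by congr pair; [apply: val_inj => /=|]; case: x y ij => [] [] //=; lia.
Qed.

Lemma shelf_key_block w a b :
  block_rank (w a) < block_rank (w b) -> shelf_key w a < shelf_key w b.
Proof.
move=> ab; rewrite /shelf_key.
have := leq_mul ab (leqnn n); rewrite mulSn.
by have := ltn_ord a; do 2 case: ifP => _; lia.
Qed.

Lemma shelf_key_shelf w a b : (w a).1 < (w b).1 -> shelf_key w a < shelf_key w b.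
Proof. by move=> ab; apply: shelf_key_block; rewrite /block_rank; lia. Qed.

Lemma shelf_key_same w a b : w a = w b ->
  (shelf_key w a < shelf_key w b) = if (w a).2 then a < b else b < a.
Proof.
move=> ab; rewrite /shelf_key ab ltn_add2l.
by have := ltn_ord a; have := ltn_ord b; case: ifP => _; lia.
Qed.

Lemma shelf_key_le_block w a b :
  shelf_key w a <= shelf_key w b -> block_rank (w a) <= block_rank (w b).
Proof. by rewrite leqNgt => ab; rewrite leqNgt; apply: contra ab; apply: shelf_key_block. Qed.

Lemma shelf_key_inj w : injective (shelf_key w).
Proof.
move=> a b kab.
have wab : w a = w b.
  by apply/block_rank_inj/eqP; rewrite eqn_leq !shelf_key_le_block ?kab.
apply: val_inj; have := shelf_key_same wab; have := shelf_key_same (esym wab).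
by rewrite kab ltnn wab; case: ifP => _ /=; lia.
Qed.

(** The cards are dealt by decreasing label, so the cards put on top of a pile end
    up increasing and those put at its bottom end up decreasing. *)
Lemma pile_after_dealE w (s : seq 'I_n) (j : 'I_m) :
  foldl (place w) (fun=> [::]) (rev s) j =
  [seq c <- s | w c == (j, true)] ++ rev [seq c <- s | w c == (j, false)].
Proof.
rewrite foldl_rev; elim: s => //= c s IHs.
rewrite {1}/place IHs; case: (w c) => i x /=; rewrite !xpair_eqE eq_sym.
case: (i == j) => //=; case: x => //=.
by rewrite rev_cons -rcons_cat.
Qed.

Lemma pairwise_flatten (T : eqType) (J : eqType) (r : rel T) (P : J -> seq T) (s : seq J) :
  (forall j, j \in s -> pairwise r (P j)) ->
  pairwise (fun i j => allrel r (P i) (P j)) s ->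
  pairwise r (flatten [seq P j | j <- s]).
Proof.
elim: s => //= j s IHs Pj /andP[js sP]; rewrite pairwise_cat Pj ?inE ?eqxx //=.
rewrite IHs // ?andbT => [|i si]; last by apply: Pj; rewrite inE si orbT.
apply/allrelP => x y xj /flatten_mapP[i si yi].
by move/allP: js => /(_ i si) /allrelP; apply.
Qed.

Lemma mem_pile w j c :
  c \in [seq c <- enum 'I_n | w c == (j, true)] ++
        rev [seq c <- enum 'I_n | w c == (j, false)] = ((w c).1 == j).
Proof.
have : c \in enum 'I_n by rewrite mem_enum.
move: (enum _) => s cs; rewrite mem_cat mem_rev !mem_filter cs !andbT.
by case: (w c) => i [] /=; rewrite !xpair_eqE /= !(andbT, andbF, orbF).
Qed.

Lemma pairwise_enum : pairwise (fun a b => a < b) (enum 'I_n).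
Proof.
have := iota_ltn_sorted 0 n; rewrite -val_enum_ord sorted_pairwise.
  by rewrite pairwise_map.
exact: ltn_trans.
Qed.

Lemma shuffled_deckE w :
  shuffled_deck w = flatten [seq [seq c <- enum 'I_n | w c == (j, true)] ++
    rev [seq c <- enum 'I_n | w c == (j, false)] | j <- enum 'I_m].
Proof. by congr flatten; apply: eq_map => j; apply: pile_after_dealE. Qed.

Lemma shuffled_deck_pairwise w :
  pairwise (fun a b => shelf_key w a < shelf_key w b) (shuffled_deck w).
Proof.
rewrite shuffled_deckE; apply: pairwise_flatten => [j _|].
  rewrite pairwise_cat; apply/and3P; split.
  - apply/allrelP => a b; rewrite mem_rev mem_filter => /andP[/eqP aj _].
    rewrite mem_filter => /andP[/eqP bj _]; apply: shelf_key_block.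
    by rewrite aj bj /block_rank /=; lia.
  - apply: (@sub_in_pairwise _ (fun c => w c == (j, true)) (fun a b => a < b)).
    + by move=> a b /eqP aj /eqP bj ab; rewrite shelf_key_same ?aj.
    + exact: filter_all.
    + exact/pairwise_filter/pairwise_enum.
  - rewrite -sorted_pairwise; last by move=> b a c; apply: ltn_trans.
    rewrite rev_sorted sorted_pairwise; last by move=> b a c /[swap]; apply: ltn_trans.
    apply: (@sub_in_pairwise _ (fun c => w c == (j, false)) (fun a b => a < b)).
    + by move=> a b /eqP aj /eqP bj ab; rewrite shelf_key_same ?bj.
    + exact: filter_all.
    + exact/pairwise_filter/pairwise_enum.
have := iota_ltn_sorted 0 m; rewrite -val_enum_ord sorted_pairwise; last exact: ltn_trans.
rewrite pairwise_map; apply: sub_pairwise => i j /= ij.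
apply/allrelP => a b; rewrite !mem_pile => /eqP ai /eqP bj.
by apply: shelf_key_shelf; rewrite ai bj.
Qed.

Lemma shuffled_deck_sort w : shuffled_deck w = deck (shelf_key w).
Proof.
have pw := shuffled_deck_pairwise w.
apply: deck_unique; first exact: shelf_key_inj.
  rewrite sorted_pairwise; last exact: key_trans.
  by apply: sub_pairwise pw => a b; apply: ltnW.
apply: uniq_perm (enum_uniq _) _.
  by apply: pairwise_uniq pw => a; rewrite ltnn.
move=> c; rewrite mem_enum shuffled_deckE; apply/flatten_mapP.
by exists (w c).1; rewrite ?mem_enum // mem_pile.
Qed.

Definition extreme w c :=
  [forall d, (w d == w c) ==> (c <= d)] || [forall d, (w d == w c) ==> (d <= c)].

(** Inside a block both neighbours of a card belong to its block, so its
    insertion creates a descent exactly when the block is decreasing. *)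
Lemma card_gain_inner w c : ~~ extreme w c ->
  card_gain (shelf_key w) c = ~~ (w c).2.
Proof.
rewrite /extreme negb_or => /andP[/forallPn[a0 +] /forallPn[b0 +]].
rewrite !negb_imply -!ltnNge => /andP[/eqP wa0 a0c] /andP[/eqP wb0 b0c].
have k_inj := @shelf_key_inj w.
(* Blocks are intervals of the deck. *)
have same d d' : w d' = w c -> shelf_key w d' <= shelf_key w d ->
    shelf_key w d < shelf_key w c -> w d = w c.
  move=> wd' d'd dc; apply/block_rank_inj/eqP; rewrite eqn_leq.
  by rewrite (shelf_key_le_block (ltnW dc)) -wd' (shelf_key_le_block d'd).
have same' d d' : w d' = w c -> shelf_key w d <= shelf_key w d' ->
    shelf_key w c < shelf_key w d -> w d = w c.
  move=> wd' d'd dc; apply/block_rank_inj/eqP; rewrite eqn_leq.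
  by rewrite (shelf_key_le_block (ltnW dc)) -wd' (shelf_key_le_block d'd).
rewrite /card_gain /gain; case top_c: (w c).2.
- have [a ac a0a] : exists2 a, covers (shelf_key w) a c & shelf_key w a0 <= shelf_key w a.
    by apply: exists_above; rewrite shelf_key_same // wa0 top_c.
  have [b cb bb0] : exists2 b, covers (shelf_key w) c b & shelf_key w b <= shelf_key w b0.
    by apply: exists_below; rewrite shelf_key_same // top_c.
  rewrite (aboveE k_inj ac) (belowE k_inj cb).
  move: ac cb => /andP[ac _] /andP[cb _].
  have wa := same _ _ wa0 a0a ac; have wb := same' _ _ wb0 bb0 cb.
  by move: ac cb; rewrite !shelf_key_same // wa top_c; lia.
- have [a ac a0a] : exists2 a, covers (shelf_key w) a c & shelf_key w b0 <= shelf_key w a.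
    by apply: exists_above; rewrite shelf_key_same // wb0 top_c.
  have [b cb bb0] : exists2 b, covers (shelf_key w) c b & shelf_key w b <= shelf_key w a0.
    by apply: exists_below; rewrite shelf_key_same // top_c.
  rewrite (aboveE k_inj ac) (belowE k_inj cb).
  move: ac cb => /andP[ac _] /andP[cb _].
  have wa := same _ _ wb0 a0a ac; have wb := same' _ _ wa0 bb0 cb.
  by move: ac cb; rewrite !shelf_key_same // wa top_c; lia.
Qed.

(** A block has one smallest and one largest card. *)
Lemma sum_extreme_le w : \sum_c extreme w c <= 4 * m.
Proof.
have inj_le (P : pred 'I_n) : (forall a b, P a -> P b -> w a = w b -> a = b) ->
    \sum_c P c <= m * 2.
  move=> P_inj; rewrite -big_mkcond /= sum1_card.
  have -> : m * 2 = #|{: 'I_m * bool}| by rewrite card_prod card_ord card_bool.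
  rewrite -(card_in_imset (f := w) (D := P)); first exact: max_card.
  by move=> a b; apply: P_inj.
apply: (@leq_trans (\sum_c ([forall d, (w d == w c) ==> (c <= d)] +
    [forall d, (w d == w c) ==> (d <= c)]))).
  by apply: leq_sum => c _; rewrite /extreme; lia.
rewrite big_split /=.
have -> : 4 * m = m * 2 + m * 2 by lia.
by apply: leq_add; apply: inj_le => a b /forallP Pa /forallP Pb ab; apply/val_inj/eqP;
  rewrite eqn_leq; have := Pa b; have := Pb a; rewrite ab eqxx /= => -> ->.
Qed.

End ShelfDeck.

(** * Descents of a shelf shuffle as a function on outcomes *)

Lemma deck_perm_ex (n : nat) (t : seq 'I_n) : perm_eq t (enum 'I_n) ->
  exists s : 'S_n, t = [seq s i | i <- enum 'I_n].
Proof.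
case: n t => [|n] t tP.
  exists 1%g; move/perm_size: tP; rewrite size_enum_ord => /size0nil->.
  by apply/esym/size0nil; rewrite size_map size_enum_ord.
have tU : uniq t by rewrite (perm_uniq tP) enum_uniq.
have t_size : size t = n.+1 by rewrite (perm_size tP) size_enum_ord.
pose f (i : 'I_n.+1) := nth i t i.
have f_inj : injective f.
  move=> i j /eqP; rewrite /f (set_nth_default i j) ?t_size // nth_uniq ?t_size //.
  by move=> /eqP/val_inj.
exists (perm f_inj).
apply: (@eq_from_nth _ ord0) => [|i]; first by rewrite size_map size_enum_ord.
rewrite t_size => i_lt; rewrite (nth_map ord0) ?size_enum_ord //.
rewrite permE /f nth_enum_ord //; apply: set_nth_default.
by rewrite t_size.
Qed.

Lemma des_sum_steps (n : nat) (s : 'S_n.+1) :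
  des s = (\sum_(i < n) (s (inord i.+1) < s (inord i)))%N.
Proof.
rewrite /des cardsE -sum1_card big_mkcond /= big_ord_recr /=.
rewrite [X in (_ + X)%N]ifF ?addn0; last first.
  by apply/negbTE/negP => /fintype.existsP[j /andP[/eqP /= jn _]];
    have := ltn_ord j; rewrite jn ltnn.
apply: eq_bigr => i _.
have -> : widen_ord (leqnSn n) i = inord i.
  by apply: val_inj; rewrite /= inordK // ltnS ltnW.
have i1 : (inord i.+1 : 'I_n.+1) = i.+1 :> nat by rewrite inordK // ltnS.
have i0 : (inord i : 'I_n.+1) = i :> nat by rewrite inordK // ltnS ltnW.
case: ifP => [/fintype.existsP[j /andP[/eqP ji js]]|/negbT/existsPn/(_ (inord i.+1))].
  by rewrite (_ : inord i.+1 = j) ?js //; apply: val_inj; rewrite /= i1 ji i0.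
by rewrite i1 i0 eqxx /= => /negPf->.
Qed.

Lemma des_deck_des (n : nat) (s : 'S_n) :
  des s = deck_des [seq s i | i <- enum 'I_n].
Proof.
rewrite /deck_des -map_comp descents_sum size_map size_enum_ord.
case: n s => [|n] s; first by rewrite big_ord0 /des eq_card0 // => -[].
have nthE (i : nat) : (i < n.+1)%N ->
    nth 0%N [seq val (s j) | j <- enum 'I_n.+1] i = s (inord i).
  move=> i_lt; rewrite (nth_map ord0) ?size_enum_ord //=; congr (val (s _)).
  by apply: val_inj; rewrite /= nth_enum_ord // inordK.
rewrite des_sum_steps big_ord_recl /= add0n; apply: eq_bigr => i _; rewrite add0n.
by rewrite /bump /= add1n (nthE i.+1) ?ltnS // (nthE i) // ltnS ltnW.
Qed.

Definition shelf_weight (R : realType) (m : nat) (p : R) (t : 'I_m * bool) : R :=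
  m%:R^-1 * (if t.2 then p else 1 - p).

Definition outcome_des (n m : nat) (w : outcome n m) : nat :=
  deck_des (deck (shelf_key w)).

Section OutcomeMean.
Variables (R : realType) (n m : nat) (p : R).

Lemma shelf_mean_des (g : nat -> R) :
  shelf_mean m p (fun s : 'S_n => g (des s)) =
  pmean (shelf_weight p) (fun w : outcome n m => g (outcome_des w)).
Proof.
rewrite /shelf_mean /shelf_law.
under eq_bigr do rewrite mulr_suml.
rewrite (exchange_big_dep predT) //=; apply: eq_bigr => w _.
have [s sw] := deck_perm_ex (deck_perm (shelf_key w)).
rewrite (big_pred1 s) => [|s' /=].
  by rewrite des_deck_des -sw.
rewrite shuffled_deck_sort sw; apply/eqP/eqP => [ss'|->//].
by apply/permP => i; have /eq_in_map -> := ss'; rewrite ?mem_enum.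
Qed.

Lemma var_des_pvar : var_des n m p =
  pvar (shelf_weight p) (fun w : outcome n m => (outcome_des w)%:R).
Proof.
rewrite /var_des /shelf_var /pvar.
rewrite (shelf_mean_des (fun d => (d%:R - shelf_mean m p (fun s : 'S_n => (des s)%:R)) ^+ 2)).
by rewrite (shelf_mean_des (fun d => d%:R)).
Qed.

Hypotheses (m_gt0 : (0 < m)%N) (p_gt0 : 0 < p) (p_lt1 : p < 1).

Lemma shelf_weight_ge0 (t : 'I_m * bool) : 0 <= shelf_weight p t.
Proof.
rewrite /shelf_weight mulr_ge0 ?invr_ge0 ?ler0n //.
by case: ifP => _; rewrite ?subr_ge0 ltW.
Qed.

Lemma sum_shelf_weight (F : bool -> R) :
  \sum_(t : 'I_m * bool) shelf_weight p t * F t.2 = p * F true + (1 - p) * F false.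
Proof.
rewrite -(pair_big predT predT (fun j b => shelf_weight p (j, b) * F b)) /=.
rewrite (eq_bigr (fun=> m%:R^-1 * (p * F true + (1 - p) * F false))).
  by rewrite sumr_const card_ord -[_ *+ m]mulr_natl mulrA mulfV ?mul1r // pnatr_eq0 -lt0n.
by move=> j _; rewrite big_bool /shelf_weight /=; ring.
Qed.

Lemma shelf_weight_sum1 : \sum_(t : 'I_m * bool) shelf_weight p t = 1.
Proof.
have := sum_shelf_weight (fun=> 1); under eq_bigr do rewrite mulr1.
by move=> ->; ring.
Qed.

(** * Few shelves *)

Definition bottom_cards (w : outcome n m) : R := \sum_c (~~ (w c).2)%:R.

(** The number of bottom cards is a sum of independent Bernoulli variables. *)
Lemma pvar_bottom_cards :
  pvar (shelf_weight p) bottom_cards = n%:R * (p * (1 - p)).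
Proof.
have sum1 := shelf_weight_sum1.
pose b (t : 'I_m * bool) : R := (~~ t.2)%:R.
have mean_b : \sum_t shelf_weight p t * b t = 1 - p.
  by rewrite (sum_shelf_weight (fun x => (~~ x)%:R)) /=; ring.
have mean_bb (c d : 'I_n) : pmean (shelf_weight p) (fun w => b (w c) * b (w d)) =
    (1 - p) ^+ 2 + (if d == c then p * (1 - p) else 0).
  case: eqVneq => [->|dc]; last first.
    by rewrite (pmean_pair sum1) 1?eq_sym // mean_b addr0.
  rewrite (pmean_single sum1 c (fun t => b t * b t)).
  rewrite (sum_shelf_weight (fun x => (~~ x)%:R * (~~ x)%:R)) /=; ring.
rewrite (pvarE sum1).
have -> : pmean (shelf_weight p) bottom_cards = n%:R * (1 - p).
  rewrite pmean_sum; under eq_bigr do rewrite (pmean_single sum1 _ b) mean_b.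
  by rewrite sumr_const card_ord mulr_natl.
have -> : pmean (shelf_weight p) (fun w => bottom_cards w ^+ 2) =
    \sum_(c < n) \sum_(d < n) ((1 - p) ^+ 2 + (if d == c then p * (1 - p) else 0)).
  under [RHS]eq_bigr do under eq_bigr do rewrite -mean_bb.
  under [RHS]eq_bigr do rewrite -pmean_sum.
  rewrite -pmean_sum; apply: eq_pmean => w.
  rewrite expr2 /bottom_cards mulr_suml; apply: eq_bigr => c _.
  by rewrite mulr_sumr.
under eq_bigr do rewrite big_split /= -big_mkcond big_pred1_eq sumr_const card_ord.
by rewrite sumr_const card_ord -[_ *+ n]mulr_natl -[_ *+ n]mulr_natl; ring.
Qed.

Definition excess (w : outcome n m) : R := (outcome_des w)%:R - bottom_cards w.

Lemma shelf_key_update (w : outcome n m) c t d : d != c ->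
  shelf_key (update w c t) d = shelf_key w d.
Proof. by move=> /negPf dc; rewrite /shelf_key /update ffunE dc. Qed.

Lemma without_shelf_key_update (w : outcome n m) c t :
  deck_without c (shelf_key (update w c t)) = deck_without c (shelf_key w).
Proof.
apply: deck_without_eq => [|d dc]; first exact: shelf_key_inj.
exact: shelf_key_update.
Qed.

(** Dropping a card that is not extreme in its block leaves the excess of
    descents over bottom cards unchanged, and there are at most [4 * m] extreme
    cards. *)
Lemma pvar_excess_le : pvar (shelf_weight p) excess <= 4 * m%:R.
Proof.
have sum1 := shelf_weight_sum1; have ge0 := shelf_weight_ge0.
pose g c (w : outcome n m) : R :=
  (deck_des (deck_without c (shelf_key w)))%:R - \sum_(d | d != c) (~~ (w d).2)%:R.
have g_free c : free_of c (g c).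
  move=> w t; rewrite /g without_shelf_key_update; congr (_ - _).
  by apply: eq_bigr => d /negPf dc; rewrite /update ffunE dc.
apply: le_trans (efron_stein ge0 sum1 excess g_free) _.
rewrite -pmean_sum -[leRHS](pmean_cst 'I_n sum1).
apply: (ler_pmean ge0) => w; rewrite -natrM.
apply: le_trans (_ : (\sum_c extreme w c)%:R <= _); last by rewrite ler_nat sum_extreme_le.
rewrite natr_sum; apply: ler_sum => c _.
have -> : excess w - g c w = (card_gain (shelf_key w) c)%:R - (~~ (w c).2)%:R.
  rewrite /excess /outcome_des /g (deck_des_insert c (@shelf_key_inj _ _ w)) natrD.
  by rewrite /bottom_cards [X in _ - X - _](bigD1 c) //=; ring.
have [//|/card_gain_inner->] := boolP (extreme w c); last by rewrite subrr expr0n.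
move=> _; have := gain_le1 (above (shelf_key w) c) c (below (shelf_key w) c).
by rewrite -/(card_gain _ c); case: card_gain => [|[|//]] _; case: (w c).2 => /=; lra.
Qed.

Lemma few_shelves_bound (eta : R) : 0 < eta ->
  `|var_des n m p - n%:R * (p * (1 - p))| <=
    eta * n%:R + (1 + eta^-1) * (4 * m%:R).
Proof.
move=> eta_gt0; rewrite var_des_pvar -pvar_bottom_cards.
apply: le_trans (pvar_perturb shelf_weight_ge0 shelf_weight_sum1 _ _ eta_gt0) _.
have eV_gt0 : 0 < eta^-1 by rewrite invr_gt0.
apply: lerD; last by rewrite ler_wpM2l ?pvar_excess_le //; lra.
rewrite ler_wpM2l ?(ltW eta_gt0) // pvar_bottom_cards ler_piMr ?ler0n //; nra.
Qed.

End OutcomeMean.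

(** * Descents of a uniform permutation *)

Section UniformPermutation.
Variables (R : realType) (n : nat).
Implicit Types (s t : 'S_n) (i j k l : 'I_n).

Definition perm_mean (F : 'S_n -> R) : R := #|{: 'S_n}|%:R^-1 * \sum_s F s.

Lemma perm_mean_relabel t F : perm_mean (fun s => F (t * s)%g) = perm_mean F.
Proof. by rewrite /perm_mean [in RHS](reindex_inj (mulgI t)). Qed.

Lemma perm_mean_cst (a : R) : perm_mean (fun=> a) = a.
Proof.
rewrite /perm_mean sumr_const -[X in _ * X]mulr_natl mulrA mulVf ?mul1r //.
by rewrite pnatr_eq0 -lt0n; apply/card_gt0P; exists 1%g.
Qed.

Lemma perm_meanD F G : perm_mean (fun s => F s + G s) = perm_mean F + perm_mean G.
Proof. by rewrite /perm_mean big_split mulrDr. Qed.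

Lemma perm_meanZ (a : R) F : perm_mean (fun s => a * F s) = a * perm_mean F.
Proof. by rewrite /perm_mean -mulr_sumr mulrCA. Qed.

Lemma perm_mean_sum (J : finType) (F : J -> 'S_n -> R) :
  perm_mean (fun s => \sum_j F j s) = \sum_j perm_mean (F j).
Proof. by rewrite /perm_mean exchange_big -mulr_sumr. Qed.

Lemma eq_perm_mean F G : F =1 G -> perm_mean F = perm_mean G.
Proof. by move=> FG; congr (_ * _); apply: eq_bigr => s _. Qed.

(** The centred indicator of an inversion: it changes sign when its two positions
    are exchanged. *)
Definition inv_sign i j s : R := if (s j < s i)%N then 2^-1 else - 2^-1.

Lemma inv_signC i j s : i != j -> inv_sign j i s = - inv_sign i j s.
Proof.
move=> ij; rewrite /inv_sign.
have : s i != s j by rewrite (inj_eq perm_inj).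
by rewrite -val_eqE /=; case: ltngtP => //; rewrite ?opprK.
Qed.

Lemma inv_sign_relabel t i j s : inv_sign i j (t * s)%g = inv_sign (t i) (t j) s.
Proof. by rewrite /inv_sign !permM. Qed.

Lemma perm_mean_sign i j : i != j -> perm_mean (inv_sign i j) = 0.
Proof.
move=> ij; suff : perm_mean (inv_sign i j) = - 1 * perm_mean (inv_sign i j) by lra.
rewrite -{1}(perm_mean_relabel (tperm i j)) -perm_meanZ; apply: eq_perm_mean => s.
by rewrite inv_sign_relabel tpermL tpermR inv_signC // mulN1r.
Qed.

(** Exchanging the positions [i] and [j] reverses the first sign only. *)
Lemma perm_mean_sign_disjoint i j k l : i != j ->
  k != i -> k != j -> l != i -> l != j ->
  perm_mean (fun s => inv_sign i j s * inv_sign k l s) = 0.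
Proof.
move=> ij ki kj li lj; set F := fun s => _.
suff : perm_mean F = - 1 * perm_mean F by lra.
rewrite -{1}(perm_mean_relabel (tperm i j)) -perm_meanZ; apply: eq_perm_mean => s.
have [ik jk il jl] : [/\ i != k, j != k, i != l & j != l] by split; rewrite eq_sym.
by rewrite /F !inv_sign_relabel tpermL tpermR !tpermD // inv_signC // mulN1r mulNr.
Qed.

(** The three signs around a 3-cycle of positions are never all equal, so their
    three pairwise products always add up to [- 1/4]; by symmetry each product has
    mean [- 1/12]. *)
Lemma perm_mean_sign_chain i j k : i != j -> j != k -> k != i ->
  perm_mean (fun s => inv_sign i j s * inv_sign j k s) = - 12^-1.
Proof.
move=> ij jk ki.
pose F a b c s := inv_sign a b s * inv_sign b c s.
(* The rotation of positions [i] to [j] to [k] to [i]. *)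
pose t : 'S_n := (tperm i j * tperm i k)%g.
have ti : t i = j by rewrite permM tpermL tpermD // eq_sym.
have tj : t j = k by rewrite permM tpermR tpermL.
have tk : t k = i.
  have ik : i != k by rewrite eq_sym.
  by rewrite permM (tpermD ik jk) tpermR.
have rot a b c : perm_mean (F (t a) (t b) (t c)) = perm_mean (F a b c).
  rewrite -[RHS](perm_mean_relabel t); apply: eq_perm_mean => s.
  by rewrite /F !inv_sign_relabel.
have e1 := rot i j k; have e2 := rot j k i; rewrite !(ti, tj, tk) in e1 e2.
have : perm_mean (fun s => F i j k s + (F j k i s + F k i j s)) = - 4^-1.
  rewrite -[RHS]perm_mean_cst; apply: eq_perm_mean => s.
  have nij : s i != s j by rewrite (inj_eq perm_inj).
  have njk : s j != s k by rewrite (inj_eq perm_inj).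
  have nki : s k != s i by rewrite (inj_eq perm_inj).
  move: nij njk nki; rewrite /F /inv_sign -!val_eqE /=.
  case: (ltngtP (s i) (s j)) => // sij _; case: (ltngtP (s j) (s k)) => // sjk _;
    case: (ltngtP (s k) (s i)) => // ski _; solve [lia | lra].
rewrite !perm_meanD -/(F i j k); lra.
Qed.

Lemma inv_sign_sqr i j s : inv_sign i j s * inv_sign i j s = 4^-1.
Proof. by rewrite /inv_sign; case: ifP => _; lra. Qed.

End UniformPermutation.

(** The mean product of the signs of the [i]-th and [j]-th steps of a uniform
    permutation. *)
Definition adjacent_cov (R : realType) (i j : nat) : R :=
  if i == j then 4^-1 else if (i == j.+1) || (j == i.+1) then - 12^-1 else 0.

Lemma sum_adjacent_cov (R : realType) (n : nat) :
  \sum_(i < n.+1) \sum_(j < n.+1) adjacent_cov R i j = (n%:R + 3) / 12.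
Proof.
elim: n => [|n IHn]; first by rewrite !big_ord1 /adjacent_cov eqxx; lra.
have last_row : \sum_(j < n.+1) adjacent_cov R n.+1 j = - 12^-1.
  rewrite big_ord_recr /= big1 => [|j _].
    by rewrite /adjacent_cov eqxx ifF ?add0r //; lia.
  by have := ltn_ord j; rewrite /adjacent_cov => jn; rewrite !ifF //; lia.
have covC i j : adjacent_cov R i j = adjacent_cov R j i.
  by rewrite /adjacent_cov eq_sym orbC.
rewrite big_ord_recr /=; under eq_bigr do rewrite big_ord_recr /=.
rewrite big_split /= IHn [X in _ + _ + X]big_ord_recr /= last_row.
under eq_bigr do rewrite covC.
rewrite last_row {1}/adjacent_cov eqxx -natr1; lra.
Qed.

Section UniformDescents.
Variables (R : realType) (n : nat).
Let pos (i : nat) : 'I_n.+2 := inord i.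

Definition centred_des (s : 'S_n.+2) : R :=
  \sum_(i < n.+1) inv_sign R (pos i) (pos i.+1) s.

Lemma pos_neq (i j : nat) : (i <= n.+1)%N -> (j <= n.+1)%N -> i != j -> pos i != pos j.
Proof. by move=> i_le j_le; apply: contra => /eqP/(congr1 val); rewrite /pos /= !inordK // => ->. Qed.

Lemma des_centred (s : 'S_n.+2) : (des s)%:R = n.+1%:R / 2 + centred_des s.
Proof.
have -> : n.+1%:R / 2 = \sum_(i < n.+1) 2^-1 :> R by rewrite sumr_const card_ord mulr_natl.
rewrite des_sum_steps natr_sum -big_split /=.
by apply: eq_bigr => i _; rewrite /inv_sign /pos; case: (_ < _)%N => /=; lra.
Qed.

Lemma perm_mean_centred_des : perm_mean centred_des = 0.
Proof.
rewrite perm_mean_sum big1 // => i _; apply: perm_mean_sign.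
by apply: pos_neq; have := ltn_ord i; lia.
Qed.

Lemma perm_mean_centred_des_sqr :
  perm_mean (fun s => centred_des s ^+ 2) = (n%:R + 3) / 12.
Proof.
transitivity (\sum_(i < n.+1) \sum_(j < n.+1) perm_mean (fun s =>
    inv_sign R (pos i) (pos i.+1) s * inv_sign R (pos j) (pos j.+1) s)).
  under [RHS]eq_bigr do rewrite -perm_mean_sum.
  rewrite -perm_mean_sum; apply: eq_perm_mean => s.
  rewrite expr2 mulr_suml; apply: eq_bigr => i _.
  by rewrite mulr_sumr.
rewrite -sum_adjacent_cov; apply: eq_bigr => i _; apply: eq_bigr => j _.
have i_lt := ltn_ord i; have j_lt := ltn_ord j.
rewrite /adjacent_cov; case: (eqVneq (i : nat) j) => [->|ij].
  by under eq_perm_mean do rewrite inv_sign_sqr; rewrite perm_mean_cst.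
case: ifP => [/orP[/eqP e|/eqP e]|nadj].
- rewrite e; under eq_perm_mean do rewrite mulrC.
  by apply: perm_mean_sign_chain; apply: pos_neq; lia.
- by rewrite e; apply: perm_mean_sign_chain; apply: pos_neq; lia.
- by apply: perm_mean_sign_disjoint; apply: pos_neq; lia.
Qed.

Lemma perm_mean_des : perm_mean (fun s : 'S_n.+2 => (des s)%:R : R) = n.+1%:R / 2.
Proof.
under eq_perm_mean do rewrite des_centred.
by rewrite perm_meanD perm_mean_cst perm_mean_centred_des addr0.
Qed.

Lemma perm_mean_des_sqr :
  perm_mean (fun s : 'S_n.+2 => (des s)%:R ^+ 2 : R) =
  (n.+1%:R / 2) ^+ 2 + (n%:R + 3) / 12.
Proof.
transitivity (perm_mean (fun s : 'S_n.+2 => (n.+1%:R / 2) ^+ 2 +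
    (n.+1%:R * centred_des s + centred_des s ^+ 2))).
  by apply: eq_perm_mean => s; rewrite des_centred; field.
rewrite !perm_meanD perm_mean_cst perm_meanZ perm_mean_centred_des.
by rewrite perm_mean_centred_des_sqr mulr0 add0r.
Qed.

End UniformDescents.

(** * Many shelves *)

Section ManyShelves.
Variables (R : realType) (n m K : nat) (p : R).
Hypotheses (m_gt0 : (0 < m)%N) (K_gt0 : (0 < K)%N) (p_gt0 : 0 < p) (p_lt1 : p < 1).

Local Notation outcomes := {ffun 'I_n -> ('I_m * bool) * 'I_K}.
Implicit Types (w : outcomes) (c d : 'I_n).

(** Besides its shelf and its end of the pile, each card draws a uniform label
    below [K]. *)
Definition labelled_weight (t : ('I_m * bool) * 'I_K) : R :=
  shelf_weight p t.1 * K%:R^-1.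

Definition forget w : outcome n m := [ffun c => (w c).1].

Definition fine_rank w c : nat := ((w c).1.1 * K + (w c).2)%N.

(** Cards are sorted by shelf, then by label; the last term makes the key
    injective when two labels coincide. *)
Definition fine_key w c : nat := (fine_rank w c * n + c)%N.

Definition fine_des w : nat := deck_des (deck (fine_key w)).

Definition shelf w c : nat := (w c).1.1.

Lemma fine_key_rank w c d : (fine_rank w c < fine_rank w d)%N ->
  (fine_key w c < fine_key w d)%N.
Proof.
move=> cd; rewrite /fine_key; have := leq_mul cd (leqnn n); rewrite mulSn.
by have := ltn_ord c; lia.
Qed.

Lemma fine_key_inj w : injective (fine_key w).
Proof.
move=> c d cd; apply: val_inj.
have [lt|lt|eq_rank] := ltngtP (fine_rank w c) (fine_rank w d).
- by have := fine_key_rank lt; rewrite cd ltnn.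
- by have := fine_key_rank lt; rewrite cd ltnn.
- by move: cd; rewrite /fine_key eq_rank => /addnI.
Qed.

Lemma fine_key_shelf w c d : (shelf w c < shelf w d)%N ->
  (fine_key w c < fine_key w d)%N.
Proof.
rewrite /shelf => cd; apply: fine_key_rank; rewrite /fine_rank.
have := leq_mul cd (leqnn K); rewrite mulSn.
by have := ltn_ord (w c).2; lia.
Qed.

Lemma forget_key_shelf w c d : (shelf w c < shelf w d)%N ->
  (shelf_key (forget w) c < shelf_key (forget w) d)%N.
Proof. by move=> cd; apply: shelf_key_shelf; rewrite !ffunE. Qed.

Lemma labelled_weight_ge0 t : 0 <= labelled_weight t.
Proof. by rewrite mulr_ge0 ?invr_ge0 ?ler0n // shelf_weight_ge0. Qed.

Lemma sum_labelled_weight (P : pred ('I_m * bool)) (Q : pred 'I_K) :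
  \sum_(t | P t.1 && Q t.2) labelled_weight t =
  (\sum_(t | P t) shelf_weight p t) * (\sum_(u | Q u) K%:R^-1).
Proof.
rewrite -(pair_big P Q (fun t u => shelf_weight p t * K%:R^-1)) /=.
by rewrite mulr_suml; apply: eq_bigr => t _; rewrite mulr_sumr.
Qed.

Lemma sum_labels : \sum_(u < K) K%:R^-1 = 1 :> R.
Proof. by rewrite sumr_const card_ord -[LHS]mulr_natl mulfV // pnatr_eq0 -lt0n. Qed.

Lemma labelled_weight_sum1 : \sum_t labelled_weight t = 1.
Proof.
have := sum_labelled_weight predT predT; rewrite /= => ->.
by rewrite sum_labels mulr1 shelf_weight_sum1.
Qed.

Lemma labelled_weight_fst t0 : \sum_(t | t.1 == t0) labelled_weight t = shelf_weight p t0.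
Proof.
have := sum_labelled_weight (pred1 t0) predT.
under eq_bigl do rewrite andbT; move=> /= ->.
by rewrite sum_labels mulr1 big_pred1_eq.
Qed.

Lemma labelled_weight_shelf j : \sum_(t | t.1.1 == j) labelled_weight t = m%:R^-1.
Proof.
have := sum_labelled_weight (fun t => t.1 == j) predT.
under eq_bigl do rewrite andbT; move=> /= ->.
rewrite sum_labels mulr1.
have -> : \sum_(t : 'I_m * bool | t.1 == j) shelf_weight p t =
    \sum_(i | i == j) \sum_b shelf_weight p (i, b) :> R.
  by rewrite pair_big; apply: eq_big => [[i b]|[i b] _] //=; rewrite andbT.
by rewrite big_pred1_eq big_bool /shelf_weight /=; ring.
Qed.

Lemma labelled_weight_label u : \sum_(t | t.2 == u) labelled_weight t = K%:R^-1.
Proof.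
have := sum_labelled_weight predT (pred1 u); move=> /= ->.
by rewrite shelf_weight_sum1 // mul1r big_pred1_eq.
Qed.

Local Notation E := (pmean labelled_weight).

Lemma pvar_forget :
  pvar labelled_weight (fun w => (outcome_des (forget w))%:R) = var_des n m p.
Proof.
rewrite var_des_pvar (pvarE labelled_weight_sum1).
rewrite (pvarE (shelf_weight_sum1 p m_gt0)).
have im (f : outcome n m -> R) : E (fun w => f (forget w)) = pmean (shelf_weight p) f.
  exact: pmean_image labelled_weight_fst.
by rewrite (im (fun v => (outcome_des v)%:R ^+ 2)) (im (fun v => (outcome_des v)%:R)).
Qed.

Lemma mean_colliding_le c : E (fun w => (colliding (shelf w) c)%:R) <= n%:R / m%:R.
Proof.
apply: (@le_trans _ _ (E (fun w => \sum_(d | d != c) ((w d).1.1 == (w c).1.1)%:R))).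
  apply: (ler_pmean labelled_weight_ge0) => w; rewrite /colliding.
  case: fintype.existsP => [[d /andP[dc ddc]]|_]; last by apply: sumr_ge0 => d _.
  rewrite (bigD1 d) //= ; move: ddc; rewrite /shelf val_eqE => ->.
  by rewrite lerDl sumr_ge0.
rewrite pmean_sum (eq_bigr (fun=> m%:R^-1)) => [|d dc].
  rewrite sumr_const -[leLHS]mulr_natl ler_wpM2r ?invr_ge0 // ler_nat.
  by apply: leq_trans (max_card _) _; rewrite card_ord.
apply: (pmean_collision labelled_weight_sum1 (h := fun t => t.1.1)) => //.
exact: labelled_weight_shelf.
Qed.

(** Dropping a card perturbs the two decks differently only if the card or one of
    its neighbours shares its shelf. *)
Lemma pvar_fine_diff_le :
  pvar labelled_weight (fun w => (outcome_des (forget w))%:R - (fine_des w)%:R) <=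
  3 * (n%:R * (n%:R / m%:R)).
Proof.
have sum1 := labelled_weight_sum1; have ge0 := labelled_weight_ge0.
pose g c w : R := (deck_des (deck_without c (shelf_key (forget w))))%:R -
   (deck_des (deck_without c (fine_key w)))%:R.
have g_free c : free_of c (g c).
  move=> w t; rewrite /g; congr (_%:R - _%:R); congr deck_des.
    apply: deck_without_eq => [|d dc]; first exact: shelf_key_inj.
    by rewrite /shelf_key !ffunE (negPf dc).
  apply: deck_without_eq => [|d dc]; first exact: fine_key_inj.
  by rewrite /fine_key /fine_rank !ffunE (negPf dc).
apply: le_trans (efron_stein ge0 sum1 _ g_free) _.
rewrite -pmean_sum.
apply: (@le_trans _ _ (E (fun w => 3 * \sum_c (colliding (shelf w) c)%:R))).
  apply: (ler_pmean ge0) => w.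
  have k_inj := @shelf_key_inj _ _ (forget w); have k'_inj := @fine_key_inj w.
  apply: (@le_trans _ _ (\sum_c perturbed (shelf w) (shelf_key (forget w)) c)%:R).
    rewrite natr_sum; apply: ler_sum => c _.
    have -> : (outcome_des (forget w))%:R - (fine_des w)%:R - g c w =
        (card_gain (shelf_key (forget w)) c)%:R - (card_gain (fine_key w) c)%:R.
      rewrite /g /outcome_des /fine_des.
      by rewrite (deck_des_insert c k_inj) (deck_des_insert c k'_inj) !natrD; ring.
    have [_|cP] := boolP (perturbed _ _ _); last first.
      rewrite (card_gain_eq k'_inj _ _ cP) ?subrr ?expr0n //.
      - exact: forget_key_shelf.
      - exact: fine_key_shelf.
    have := gain_le1 (above (shelf_key (forget w)) c) c (below (shelf_key (forget w)) c).
    have := gain_le1 (above (fine_key w) c) c (below (fine_key w) c).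
    rewrite -!/(card_gain _ _).
    by case: card_gain => [|[|//]] _; case: card_gain => [|[|//]] _ /=; lra.
  by rewrite -natr_sum -natrM ler_nat; apply: sum_perturbed_le.
rewrite pmeanZ ler_wpM2l // pmean_sum.
apply: le_trans (_ : \sum_(c < n) n%:R / m%:R <= _); last first.
  by rewrite sumr_const card_ord -[leLHS]mulr_natl.
by apply: ler_sum => c _; apply: mean_colliding_le.
Qed.

(** * Distinct labels make the finer deck uniform *)

Definition distinct_labels w : bool :=
  [forall c, forall d, ((w c).2 == (w d).2) ==> (c == d)].

Lemma distinct_labelsP w c d : distinct_labels w -> (w c).2 = (w d).2 -> c = d.
Proof. by move=> /forallP/(_ c)/forallP/(_ d)/implyP wP /eqP/wP/eqP. Qed.

Definition relabel (t : 'S_n) w : outcomes := [ffun c => w (t c)].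

Lemma distinct_relabel t w : distinct_labels (relabel t w) = distinct_labels w.
Proof.
apply/forallP/forallP => wP c; apply/forallP => d; apply/implyP => cd.
  have /forallP/(_ (t^-1%g d))/implyP := wP (t^-1%g c).
  by rewrite !ffunE !permKV => /(_ cd)/eqP/perm_inj->.
have /forallP/(_ (t d))/implyP := wP (t c).
by move: cd; rewrite !ffunE => cd /(_ cd)/eqP/perm_inj->.
Qed.

Lemma fine_deck_relabel (t : 'S_n) w : distinct_labels w ->
  [seq t c | c <- deck (fine_key (relabel t w))] = deck (fine_key w).
Proof.
move=> wP; apply: deck_unique; first exact: fine_key_inj.
  rewrite sorted_map; apply: sub_sorted (sort_sorted (@key_total _ _) _) => c d.
  rewrite /= => cd; have [tcd|] := eqVneq (t c) (t d); first by rewrite tcd.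
  move=> tcd; apply/ltnW/fine_key_rank.
  have rcd : fine_rank w (t c) != fine_rank w (t d).
    apply: contra tcd => /eqP rcd; apply/eqP/(distinct_labelsP wP)/val_inj => /=.
    have := congr1 (modn^~ K) rcd.
    by rewrite /fine_rank !modnMDl !modn_small ?ltn_ord.
  rewrite ltn_neqAle rcd leqNgt /=; apply/negP => rdc.
  have := @fine_key_rank (relabel t w) d c; rewrite /fine_rank !ffunE => /(_ rdc).
  by rewrite ltnNge cd.
apply: uniq_perm (enum_uniq _) _; first by rewrite map_inj_uniq ?deck_uniq //; apply: perm_inj.
move=> c; rewrite mem_enum; apply/mapP; exists (t^-1%g c); first exact: mem_deck.
by rewrite permKV.
Qed.

Lemma perm_mean_fine_des w (F : nat -> R) : distinct_labels w ->
  perm_mean (fun t => F (fine_des (relabel t w))) =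
  perm_mean (fun s : 'S_n => F (des s)).
Proof.
move=> wP; have [s sP] := deck_perm_ex (deck_perm (fine_key w)).
have fineE t : fine_des (relabel t w) = des (s * t^-1)%g.
  rewrite des_deck_des /fine_des; congr deck_des.
  apply: (inj_map (@perm_inj _ t)); rewrite fine_deck_relabel // sP -[in RHS]map_comp.
  by apply: eq_map => c; rewrite /= permM permKV.
rewrite -[RHS](perm_mean_relabel s) /perm_mean [in RHS](reindex_inj invg_inj) /=.
by congr (_ * _); apply: eq_bigr => t _; rewrite fineE.
Qed.

(** The weights are exchangeable, so the outcome can be relabelled by a uniform
    permutation; this makes the finer deck uniform. *)
Lemma mean_distinct (F : nat -> R) :
  E (fun w => (distinct_labels w)%:R * F (fine_des w)) =
  E (fun w => (distinct_labels w)%:R) * perm_mean (fun s : 'S_n => F (des s)).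
Proof.
set M := perm_mean _; set f := fun w => _.
transitivity (perm_mean (fun t : 'S_n => E (fun w => f (relabel t w)))).
  rewrite -[LHS](@perm_mean_cst _ n); apply: eq_perm_mean => t.
  by rewrite -(pmean_perm _ t f).
rewrite /perm_mean -pmean_sum -pmeanZ mulrC -pmeanZ; apply: eq_pmean => w.
rewrite -/(perm_mean (fun t => f (relabel t w))) /f.
under eq_perm_mean do rewrite distinct_relabel.
rewrite perm_meanZ; case: (boolP (distinct_labels w)) => [wP|_]; last by rewrite mul0r mulr0.
by rewrite perm_mean_fine_des // mulrC.
Qed.

Lemma mean_not_distinct_le :
  E (fun w => (~~ distinct_labels w)%:R) <= n%:R * (n%:R / K%:R).
Proof.
have sum1 := labelled_weight_sum1; have ge0 := labelled_weight_ge0.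
apply: (@le_trans _ _ (E (fun w =>
    \sum_c \sum_(d | d != c) ((w d).2 == (w c).2)%:R))).
  apply: (ler_pmean ge0) => w.
  have [_|/forallPn[c /forallPn[d]]] := boolP (distinct_labels w).
    by apply: sumr_ge0 => c _; apply: sumr_ge0 => d _.
  rewrite negb_imply => /andP[cd dc] /=.
  rewrite (bigD1 c) //= (bigD1 d) 1?eq_sym //= (eqP cd) eqxx -addrA lerDl.
  by rewrite addr_ge0 ?sumr_ge0 // => c' _; apply: sumr_ge0 => d' _.
rewrite pmean_sum; apply: le_trans (_ : \sum_(c < n) n%:R / K%:R <= _); last first.
  by rewrite sumr_const card_ord -[leLHS]mulr_natl.
apply: ler_sum => c _; rewrite pmean_sum (eq_bigr (fun=> K%:R^-1)) => [|d dc].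
  rewrite sumr_const -[leLHS]mulr_natl ler_wpM2r ?invr_ge0 // ler_nat.
  by apply: leq_trans (max_card _) _; rewrite card_ord.
apply: (pmean_collision sum1 (h := fun t => t.2)) => //.
exact: labelled_weight_label.
Qed.

Lemma des_le (s : 'S_n) : (des s <= n)%N.
Proof.
rewrite des_deck_des; apply: leq_trans (descents_le _) _.
by rewrite size_map size_map size_enum_ord.
Qed.

(** The two means differ only through the outcomes with coinciding labels. *)
Lemma mean_fine_des_close (F : nat -> R) (C : R) :
  (forall x : nat, (x <= n)%N -> 0 <= F x <= C) ->
  `|E (fun w => F (fine_des w)) - perm_mean (fun s : 'S_n => F (des s))| <=
  C * (n%:R * (n%:R / K%:R)).
Proof.
move=> FC; have sum1 := labelled_weight_sum1; have ge0 := labelled_weight_ge0.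
set M := perm_mean _.
have M_bounds : 0 <= M <= C.
  have N_ge0 : 0 <= #|{: 'S_n}|%:R^-1 :> R by rewrite invr_ge0.
  apply/andP; split.
    by rewrite mulr_ge0 ?sumr_ge0 // => s _; have /andP[] := FC _ (des_le s).
  rewrite -[leRHS](@perm_mean_cst _ n) ler_wpM2l // ler_sum // => s _.
  by have /andP[] := FC _ (des_le s).
have -> : E (fun w => F (fine_des w)) - M =
    E (fun w => (~~ distinct_labels w)%:R * (F (fine_des w) - M)).
  transitivity (E (fun w => (distinct_labels w)%:R * F (fine_des w)) -
      E (fun w => (distinct_labels w)%:R) * M +
      E (fun w => (~~ distinct_labels w)%:R * (F (fine_des w) - M))).
    rewrite mulrC -pmeanZ -pmeanB -pmeanD -{1}(pmean_cst 'I_n sum1 M) -pmeanB.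
    by apply: eq_pmean => w; case: distinct_labels => /=; ring.
  by rewrite mean_distinct -/M subrr add0r.
apply: le_trans (ler_norm_pmean ge0 _) _.
apply: (@le_trans _ _ (E (fun w => C * (~~ distinct_labels w)%:R))).
  apply: (ler_pmean ge0) => w; rewrite normrM normr_nat mulrC ler_wpM2r //.
  have /andP[F_ge0 F_le] := FC _ (deck_des_le (fine_key w)).
  by move: M_bounds F_ge0 F_le => /andP[? ?]; rewrite -/(fine_des w) ler_norml; lra.
rewrite pmeanZ ler_wpM2l ?mean_not_distinct_le //.
by have /andP[? ?] := M_bounds; lra.
Qed.

End ManyShelves.

Lemma perm_mean_des_moments (R : realType) (n : nat) : (1 < n)%N ->
  perm_mean (fun s : 'S_n => (des s)%:R : R) = (n%:R - 1) / 2 /\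
  perm_mean (fun s : 'S_n => (des s)%:R ^+ 2 : R) =
    ((n%:R - 1) / 2) ^+ 2 + (n%:R + 1) / 12.
Proof.
case: n => [|[|n]] // _; split.
  by rewrite perm_mean_des -!natr1; field.
by rewrite perm_mean_des_sqr -!natr1; field.
Qed.

Lemma many_shelves_bound (R : realType) (n m : nat) (p eta : R) :
  (1 < n)%N -> (0 < m)%N -> 0 < p -> p < 1 -> 0 < eta ->
  `|var_des n m p - n%:R / 12| <=
    eta * n%:R + (1 + eta^-1) * (3 * (n%:R * (n%:R / m%:R))) + 2.
Proof.
move=> n_gt1 m_gt0 p_gt0 p_lt1 eta_gt0.
(* With this [K], the variance of [D'] is within 1 of [(n + 1) / 12]. *)
pose K := (3 * n ^ 4)%N.
have K_gt0 : (0 < K)%N by rewrite muln_gt0 expn_gt0 (ltnW n_gt1).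
pose nu := @labelled_weight R m K p.
have ge0 : forall t, 0 <= nu t := labelled_weight_ge0 p_gt0 p_lt1.
have sum1 : \sum_t nu t = 1 := labelled_weight_sum1 p m_gt0 K_gt0.
pose D' (w : {ffun 'I_n -> ('I_m * bool) * 'I_K}) : R := (fine_des w)%:R.
set N : R := n%:R.
have N_ge2 : 2 <= N by rewrite ler_nat.
set rho := N * (N / K%:R) : R.
have rho_bound : 3 * N ^+ 2 * rho = 1.
  by rewrite /rho /K natrM natrX -/N; field; lra.
have [U1 U2] := perm_mean_des_moments R n_gt1.
have D'_le w : 0 <= D' w <= N by rewrite ler0n ler_nat deck_des_le.
have var_close : `|pvar nu D' - (N + 1) / 12| <= 1.
  rewrite (pvarE sum1).
  have := @mean_fine_des_close R n m K p m_gt0 K_gt0 p_gt0 p_lt1 (fun d => d%:R) N.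
  rewrite U1 -/nu -/N -/rho -/D' => close1.
  have := @mean_fine_des_close R n m K p m_gt0 K_gt0 p_gt0 p_lt1 (fun d => d%:R ^+ 2) (N ^+ 2).
  rewrite U2 -/nu -/N -/rho => close2.
  set e1 := pmean nu D'; set e2 := pmean nu _.
  have e1_bounds : 0 <= e1 <= N.
    rewrite (pmean_ge0 ge0 sum1) => [|w]; last by have /andP[] := D'_le w.
    rewrite -[leRHS](pmean_cst 'I_n sum1); apply: (ler_pmean ge0) => w.
    by have /andP[] := D'_le w.
  have {}close1 : `|e1 - (N - 1) / 2| <= N * rho.
    by apply: close1 => d d_le; rewrite ler0n ler_nat.
  have {}close2 : `|e2 - (((N - 1) / 2) ^+ 2 + (N + 1) / 12)| <= N ^+ 2 * rho.
    apply: close2 => d d_le; rewrite sqr_ge0 lerXn2r ?nnegrE ?ler0n ?ler_nat //.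
  have -> : e2 - e1 ^+ 2 - (N + 1) / 12 =
      (e2 - (((N - 1) / 2) ^+ 2 + (N + 1) / 12)) -
      (e1 - (N - 1) / 2) * (e1 + (N - 1) / 2) by field.
  apply: le_trans (ler_normB _ _) _; rewrite normrM.
  have sum_le : `|e1 + (N - 1) / 2| <= 2 * N by rewrite ler_norml; lra.
  have := ler_pM (normr_ge0 _) (normr_ge0 _) close1 sum_le.
  have -> : N * rho * (2 * N) = 2 * (N ^+ 2 * rho) by ring.
  lra.
have := pvar_perturb ge0 sum1 (fun w => (outcome_des (forget w))%:R) D' eta_gt0.
rewrite (pvar_forget n p m_gt0 K_gt0).
have := @pvar_fine_diff_le R n m K p m_gt0 K_gt0 p_gt0 p_lt1; rewrite -/nu -/N -/D'.
have eV_gt0 : 0 < eta^-1 by rewrite invr_gt0.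
set V := pvar nu D' in var_close *; set F := pvar nu _ => F_le V_close.
have eF : (1 + eta^-1) * F <= (1 + eta^-1) * (3 * (N * (N / m%:R))).
  by rewrite ler_wpM2l //; lra.
have V_le : eta * V <= eta * N.
  by rewrite ler_wpM2l ?(ltW eta_gt0) //; move: var_close; rewrite ler_norml; lra.
move: var_close V_close; rewrite !ler_norml; lra.
Qed.

(** * Limits *)

Local Open Scope classical_set_scope.
Local Open Scope ring_scope.

Lemma cvg_ereal_sup0 (R : realType) (P : set R) (f : nat -> R -> R) : P !=set0 ->
  (forall eps, 0 < eps ->
     \forall n \near \oo, forall p, P p -> `|f n p| <= eps) ->
  ereal_sup [set (`|f n p|)%:E | p in P] @[n --> \oo] --> 0%E.
Proof.
move=> [p0 Pp0] f_small.
have sup_ge0 n : (0 <= ereal_sup [set (`|f n p|)%:E | p in P])%E.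
  apply: le_trans (ereal_sup_ubound _); last by exists p0.
  by rewrite lee_fin.
have sup_le n eps : (forall p, P p -> `|f n p| <= eps) ->
    (ereal_sup [set (`|f n p|)%:E | p in P] <= eps%:E)%E.
  by move=> f_le; apply: ge_ereal_sup => _ [p Pp <-]; rewrite lee_fin f_le.
apply/fine_cvgP; split.
  near=> n; rewrite ge0_fin_numE //; apply: le_lt_trans (ltry 1).
  by apply: sup_le; near: n; apply: f_small.
apply/cvgrPdist_le => eps eps_gt0; near=> n.
rewrite sub0r normrN /=.
have sup_le_eps : (ereal_sup [set (`|f n p|)%:E | p in P] <= eps%:E)%E.
  by apply: sup_le; near: n; apply: f_small.
rewrite ger0_norm ?fine_ge0 // -lee_fin fineK // ge0_fin_numE //.
exact: le_lt_trans sup_le_eps (ltry _).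
Unshelve. all: by end_near.
Qed.

Lemma var_des_few_shelves (R : realType) (m : nat -> nat) (eps : R) :
  (forall n, (0 < m n)%N) -> (m n)%:R / n%:R @[n --> \oo] --> (0 : R) -> 0 < eps ->
  \forall n \near \oo, forall p : R, 0 < p < 1 ->
    `|var_des n (m n) p / n%:R - p * (1 - p)| <= eps.
Proof.
move=> m_gt0 /cvgrPdist_le m_small eps_gt0.
(* The error terms [eta] and [(1 + eta^-1) * 4 * (m n / n)] get [eps / 2] each. *)
pose eta := eps / 2; pose delta := eta / ((1 + eta^-1) * 4).
have eta_gt0 : 0 < eta by rewrite /eta; lra.
have etaV_gt0 : 0 < eta^-1 by rewrite invr_gt0.
have deltaE : (1 + eta^-1) * 4 * delta = eta.
  by rewrite /delta mulrC divfK // gt_eqF //; lra.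
have delta_gt0 : 0 < delta by rewrite divr_gt0 //; lra.
near=> n => p /andP[p_gt0 p_lt1].
have n_gt0 : 0 < n%:R :> R by rewrite ltr0n; near: n; apply: nbhs_infty_gt.
have ratio_le : (m n)%:R / n%:R <= delta.
  have : `|0 - (m n)%:R / n%:R| <= delta by near: n; apply: m_small.
  by rewrite sub0r normrN ger0_norm // divr_ge0.
have := few_shelves_bound n (m_gt0 n) p_gt0 p_lt1 eta_gt0.
have -> : var_des n (m n) p / n%:R - p * (1 - p) =
    (var_des n (m n) p - n%:R * (p * (1 - p))) / n%:R by field; lra.
rewrite normrM normfV (gtr0_norm n_gt0) ler_pdivrMr //; move/le_trans; apply.
have -> : (m n)%:R = (m n)%:R / n%:R * n%:R :> R by field; lra.
rewrite mulrA mulrA -mulrDl ler_pM2r // -lerBrDl.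
have -> : eps - eta = (1 + eta^-1) * 4 * delta by rewrite deltaE /eta; lra.
by rewrite ler_wpM2l //; lra.
Unshelve. all: by end_near.
Qed.

Lemma var_des_many_shelves (R : realType) (m : nat -> nat) (eps : R) :
  (forall n, (0 < m n)%N) ->
  (m n)%:R / n%:R @[n --> \oo] --> (+oo : set_system R) -> 0 < eps ->
  \forall n \near \oo, forall p : R, 0 < p < 1 ->
    `|var_des n (m n) p / n%:R - 12%:R^-1| <= eps.
Proof.
move=> m_gt0 /cvgryPge m_large eps_gt0.
(* The error terms [eta], [(1 + eta^-1) * 3 * (n / m n)] and [2 / n] get [eps / 3]
   each. *)
pose eta := eps / 3; pose delta := eta / ((1 + eta^-1) * 3).
have eta_gt0 : 0 < eta by rewrite /eta; lra.
have etaV_gt0 : 0 < eta^-1 by rewrite invr_gt0.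
have deltaE : (1 + eta^-1) * 3 * delta = eta.
  by rewrite /delta mulrC divfK // gt_eqF //; lra.
have delta_gt0 : 0 < delta by rewrite divr_gt0 //; lra.
near=> n => p /andP[p_gt0 p_lt1].
have n_gt1 : (1 < n)%N by near: n; apply: nbhs_infty_gt.
have n_gt0 : 0 < n%:R :> R by rewrite ltr0n ltnW.
have M_gt0 : 0 < (m n)%:R :> R by rewrite ltr0n.
have ratio_le : n%:R / (m n)%:R <= delta.
  have : delta^-1 <= (m n)%:R / n%:R by near: n; apply: m_large.
  by rewrite -[n%:R / _]invf_div invf_ple // posrE ?divr_gt0.
have n_large : 2 <= eta * n%:R.
  have : 2 / eta <= n%:R by near: n; apply: nbhs_infty_ger.
  by rewrite ler_pdivrMr // mulrC.
have := many_shelves_bound n_gt1 (m_gt0 n) p_gt0 p_lt1 eta_gt0.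
have -> : var_des n (m n) p / n%:R - 12%:R^-1 =
    (var_des n (m n) p - n%:R / 12) / n%:R by field; lra.
rewrite normrM normfV (gtr0_norm n_gt0) ler_pdivrMr //; move/le_trans; apply.
have -> : eps = eta + (1 + eta^-1) * 3 * delta + eta by rewrite deltaE /eta; lra.
have : (1 + eta^-1) * 3 * (n%:R / (m n)%:R) <= (1 + eta^-1) * 3 * delta.
  by rewrite ler_wpM2l //; lra.
move/(ler_wpM2r (ltW n_gt0)).
have -> : (1 + eta^-1) * (3 * (n%:R * (n%:R / (m n)%:R))) =
  (1 + eta^-1) * 3 * (n%:R / (m n)%:R) * n%:R by ring.
rewrite !mulrDl; lra.
Unshelve. all: by end_near.
Qed.

Theorem theorem2p12 (R : realType) (m : nat -> nat)
    (m_gt0 : forall n, (0 < m n)%N) :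
  ((m n)%:R / n%:R @[n --> \oo] --> (0 : R) ->
     ereal_sup [set (`|var_des n (m n) p / n%:R - p * (1 - p)|)%:E
               | p in [set p : R | 0 < p < 1]] @[n --> \oo] --> 0%E
     /\ forall p : R, 0 < p < 1 ->
          var_des n (m n) p / n%:R @[n --> \oo] --> p * (1 - p))
  /\
  ((m n)%:R / n%:R @[n --> \oo] --> (+oo : set_system R) ->
     ereal_sup [set (`|var_des n (m n) p / n%:R - 12%:R^-1|)%:E
               | p in [set p : R | 0 < p < 1]] @[n --> \oo] --> 0%E).
Proof.
have half_in : [set p : R | 0 < p < 1] !=set0 by exists 2^-1 => /=; lra.
split=> [m_small|m_large]; last first.
  by apply: cvg_ereal_sup0 => // eps; apply: var_des_many_shelves.
split; first by apply: cvg_ereal_sup0 => // eps; apply: var_des_few_shelves.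
move=> p p01; apply/cvgrPdist_le => eps eps_gt0.
have := var_des_few_shelves m_gt0 m_small eps_gt0; apply: filterS => n /(_ p p01).
by rewrite distrC.
Qed.
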